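(* Let $\mathbb{F}$ be a free group (possibly of infinite rank) and let $\Phi:\mathbb{F}\to\mathbb{F}$ be an injective endomorphism. Then the mapping torus $M(\Phi)$ is coherent.
   Context: A group is coherent if each of its finitely generated subgroups is finitely presented. For a group endomorphism $\Phi:G\to G$, the mapping torus $M(\Phi)$ is the HNN-extension $G*_G$ whose bonding maps are the identity and $\Phi$; i.e. $M(\Phi)$ is generated by $G$ and a stable letter $t$ subject to the relations of $G$ and $tgt^{-1}=\Phi(g)$ for all $g\in G$. *)

(* Defs.v *)
From HB Require Import structures.
From mathcomp Require Import all_boot.
From mathcomp Require Import boolp classical_sets.

Set Implicit Arguments.
Unset Strict Implicit.
Unset Printing Implicit Defensive.

Local Open Scope group_scope.
Local Open Scope quotient_scope.
Local Open Scope classical_set_scope.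

Notation group_hom G H := (UMagmaMorphism.type G H).

Definition isomorphic (G H : groupType) : Prop :=
  exists f : group_hom G H, bijective f.

(* The letter (x, false) stands for the generator x and (x, true) for x^-1. *)
Definition word (X : choiceType) : Type := seq (X * bool).

HB.instance Definition _ (X : choiceType) := Choice.on (word X).

Definition winv (X : choiceType) (w : word X) : word X :=
  rev [seq (a.1, ~~ a.2) | a <- w].

(* Equality in the group < X | R >: the congruence generated by free
   cancellation and by r = 1 for every relator r in R. *)
Inductive pres_eq (X : choiceType) (R : set (word X)) :
    word X -> word X -> Prop :=
| pres_cancel u v x b :
    pres_eq R (u ++ [:: (x, b); (x, ~~ b)] ++ v) (u ++ v)
| pres_relator u v r : R r -> pres_eq R (u ++ r ++ v) (u ++ v)
| pres_refl u : pres_eq R u u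
| pres_sym u v : pres_eq R u v -> pres_eq R v u
| pres_trans u v w : pres_eq R u v -> pres_eq R v w -> pres_eq R u w.

Section Presented.
Variables (X : choiceType) (R : set (word X)).
Implicit Types u v w : word X.

Definition pres_rel : rel (word X) := fun u v => `[< pres_eq R u v >].

Lemma pres_rel_refl : reflexive pres_rel.
Proof. by move=> u; apply/asboolP/pres_refl. Qed.

Lemma pres_rel_sym : symmetric pres_rel.
Proof. by move=> u v; apply/asboolP/asboolP; apply: pres_sym. Qed.

Lemma pres_rel_trans : transitive pres_rel.
Proof.
by move=> v u w /asboolP uv /asboolP vw; apply/asboolP/(pres_trans uv vw).
Qed.

Canonical pres_equiv := EquivRel pres_rel pres_rel_refl pres_rel_sym
  pres_rel_trans.

Definition presented : Type := {eq_quot pres_equiv}.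

HB.instance Definition _ := Choice.on presented.
HB.instance Definition _ := EqQuotient.on presented.

Definition pres_class (w : word X) : presented := \pi_presented w.

Lemma pres_classP u v : pres_class u = pres_class v <-> pres_eq R u v.
Proof.
rewrite /pres_class; split=> [/eqmodP /asboolP //|uv].
by apply/eqmodP/asboolP.
Qed.

Lemma pres_eq_cat u u' v v' :
  pres_eq R u u' -> pres_eq R v v' -> pres_eq R (u ++ v) (u' ++ v').
Proof.
move=> uu' vv'; apply: (@pres_trans _ _ _ (u' ++ v)).
  elim: uu' => {u u'}.
  - by move=> u w x b; rewrite -!catA; apply: pres_cancel.
  - by move=> u w r Rr; rewrite -!catA; apply: pres_relator.
  - by move=> u; apply: pres_refl.
  - by move=> u w _; apply: pres_sym.
  - by move=> u w t _ uw _; apply: pres_trans.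
elim: vv' => {v v'}.
- by move=> v w x b; rewrite 2!(catA u'); apply: pres_cancel.
- by move=> v w r Rr; rewrite 2!(catA u'); apply: pres_relator.
- by move=> v; apply: pres_refl.
- by move=> v w _; apply: pres_sym.
- by move=> v w t _ vw _; apply: pres_trans.
Qed.

Lemma winvK : involutive (@winv X).
Proof.
move=> w; rewrite /winv map_rev revK -map_comp -[RHS]map_id.
by apply: eq_map => -[x b] /=; rewrite negbK.
Qed.

Lemma pres_eqVw w : pres_eq R (winv w ++ w) [::].
Proof.
elim: w => [|[x b] w IHw]; first exact: pres_refl.
rewrite /winv /= rev_cons -cats1 -catA /=.
apply: pres_trans IHw.
by have := pres_cancel R (winv w) w x (~~ b); rewrite negbK.
Qed.

Lemma pres_eqwV w : pres_eq R (w ++ winv w) [::].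
Proof. by rewrite -{1}[w]winvK; apply: pres_eqVw. Qed.

Lemma pres_eq_winv u v : pres_eq R u v -> pres_eq R (winv u) (winv v).
Proof.
move=> uv; apply: (@pres_trans _ _ _ (winv u ++ (v ++ winv v))).
  rewrite -{1}[winv u]cats0.
  exact/pres_eq_cat/pres_sym/pres_eqwV/pres_refl.
rewrite catA -{2}[winv v]cat0s; apply: pres_eq_cat (pres_refl _ _).
apply: pres_trans (pres_eqVw u).
exact/pres_eq_cat/pres_sym/uv/pres_refl.
Qed.

Definition pres_mul (a b : presented) : presented :=
  pres_class (repr a ++ repr b).
Definition pres_one : presented := pres_class [::].
Definition pres_inv (a : presented) : presented := pres_class (winv (repr a)).

Lemma pres_reprK (a : presented) : pres_class (repr a) = a.
Proof. exact: reprK. Qed.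

Lemma pres_repr w : pres_eq R (repr (pres_class w)) w.
Proof. by apply/pres_classP; rewrite pres_reprK. Qed.

Lemma pres_mulE u v :
  pres_mul (pres_class u) (pres_class v) = pres_class (u ++ v).
Proof. by apply/pres_classP/pres_eq_cat; apply: pres_repr. Qed.

Lemma pres_invE u : pres_inv (pres_class u) = pres_class (winv u).
Proof. exact/pres_classP/pres_eq_winv/pres_repr. Qed.

Lemma pres_mulA : associative pres_mul.
Proof.
move=> a b c; rewrite -[a]pres_reprK -[b]pres_reprK -[c]pres_reprK.
by rewrite !pres_mulE catA.
Qed.

Lemma pres_mul1 : left_id pres_one pres_mul.
Proof. by move=> a; rewrite -[a]pres_reprK pres_mulE. Qed.

Lemma pres_mulr1 : right_id pres_one pres_mul.
Proof. by move=> a; rewrite -[a]pres_reprK pres_mulE cats0. Qed.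

Lemma pres_mulV : left_inverse pres_one pres_inv pres_mul.
Proof.
move=> a; rewrite -[a]pres_reprK pres_invE pres_mulE.
exact/pres_classP/pres_eqVw.
Qed.

Lemma pres_mulrV : right_inverse pres_one pres_inv pres_mul.
Proof.
move=> a; rewrite -[a]pres_reprK pres_invE pres_mulE.
exact/pres_classP/pres_eqwV.
Qed.

HB.instance Definition _ := isGroup.Build presented
  pres_mulA pres_mul1 pres_mulr1 pres_mulV pres_mulrV.

End Presented.

Definition free_group (X : choiceType) : groupType := presented (@set0 (word X)).

Definition is_free (G : groupType) : Prop :=
  exists X : choiceType, isomorphic (free_group X) G.

Section MappingTorus.
Variables (G : groupType) (Phi : group_hom G G).

(* The presentation of the HNN extension with t g t^-1 = Phi g.
   The generators are the elements of G, injected by Some, together with the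
   stable letter t, encoded as None. *)
Definition tor_elt (g : G) : word (option G) := [:: (Some g, false)].
Definition tor_t : word (option G) := [:: (None, false)].

(* The relations of G are given by its multiplication table. *)
Definition torus_relators : set (word (option G)) :=
  [set tor_elt gh.1 ++ tor_elt gh.2 ++ winv (tor_elt (gh.1 * gh.2))
    | gh in [set: G * G]] `|`
  [set tor_t ++ tor_elt g ++ winv tor_t ++ winv (tor_elt (Phi g))
    | g in [set: G]].

Definition mapping_torus : groupType := presented torus_relators.

End MappingTorus.

(* A groupClosed predicate is boolean-valued; with the classical axioms of boolp
   every subgroup is given by one. *)
Definition subgroup_type (G : groupType) (H : groupClosed G) : Type :=
  {x : G | x \in H}.

Section SubgroupType.
Variables (G : groupType) (H : groupClosed G).

HB.instance Definition _ := SubChoice.on (subgroup_type H).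

Lemma subgroup_type_closed : group_closed (fun x : G => x \in H).
Proof. by split=> [|x y xH yH]; [apply: gpred1 | apply: gpredF]. Qed.

HB.instance Definition _ := SubChoice_isSubGroup.Build G (fun x : G => x \in H)
  (subgroup_type H) subgroup_type_closed.

End SubgroupType.

Definition finitely_generated (G : groupType) : Prop :=
  exists s : seq G, forall K : groupClosed G,
    {subset s <= K} -> forall x : G, x \in K.

Definition finitely_presented (G : groupType) : Prop :=
  exists (n : nat) (R : seq (word 'I_n)), isomorphic (presented [set` R]) G.

Definition coherent (G : groupType) : Prop :=
  forall H : groupClosed G,
    finitely_generated (subgroup_type H) -> finitely_presented (subgroup_type H).

(* Main.v *)
From HB Require Import structures.
From mathcomp Require Import all_boot all_algebra.
From mathcomp Require Import finmap monalg.
From mathcomp Require Import boolp classical_sets ring zify.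
Require Import Defs.

(** Let H be a finitely generated subgroup of the mapping torus.  Either the
stable letter has exponent 0 in every element of H, and H is conjugate to a
subgroup of the base, or H contains an element t of least positive exponent.
In the second case t acts on a conjugate of the base F as an injective
endomorphism Psi, and H = <t, S> for a finite subset S of F.  Write E a b for
the subgroup of F generated by the Psi^l(S) with a <= l < b.  Then H is the
direct limit of the groups
  G_n = < E 0 n, t | t e t^-1 = Psi(e) for e in E 0 (n-1) >,
and G_n -> H is an isomorphism as soon as, for every q >= n, the group
E 0 (q+1) is the amalgam of E 0 q and E 1 (q+1) over E 1 q: the map from E 0 n
to G_n can then be extended, one q at a time ([tower]), to homomorphisms
E 0 q -> G_n that are compatible with Psi, and a relation between t and E 0 n
that holds in H holds in G_n because it is the image of a relation in some
E 0 q.  The groups E 0 n are finitely presented, being retracts of finitely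
generated free groups ([free_fg_pres]).

To recognize amalgams, let k be the field of rational numbers and let cker E be
the kernel of k[F] -> k[F/E], a left ideal of k[F].  If Q is contained in P and
in R, and cker P /\ cker R is contained in cker Q, then <P, R> is the amalgam
of P and R over Q ([amalgam_ext]): a reduced word with value 1 is a closed path
in the bipartite graph whose vertices are the cosets of P and of R and whose
edges are the cosets of Q, and the alternating sum of its edges lies in cker P
and in cker R.  So it is enough that the increasing sequence of ideals
K_n = cker (E 0 1) /\ cker (E 1 n) be stationary ([cker_stable]).

This is a rank computation.  As F is free, all the ideals cker E are projective
([cker_projective]), so that the sequence
  0 -> K_n -> cker (E 0 1) + cker (E 1 n) -> cker (E 0 n) -> 0,
with a direct sum in the middle, splits.  Let I be the augmentation ideal and
d_n the dimension of cker (E 0 n) / I cker (E 0 n); since Psi maps E 0 (n-1)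
onto E 1 n, the dimension of K_n / I K_n is at most |S| + d_(n-1) - d_n, hence
at most |S| as soon as d_(n-1) <= d_n ([cap_dim_le]).  A sequence of natural
numbers does not decrease forever, so this happens for infinitely many n, and
K / I K is finite dimensional for the union K of the K_n.  Now embed K in a free module by means
of a section of a free module onto cker of the union of the E 1 n.  Only
finitely many coordinates are nonzero on representatives of a basis of K / I K;
the image B of K by any other coordinate satisfies B = I B, hence vanishes,
because the powers of I intersect in 0 ([aug_eq0], by means of the Magnus
expansion).  Therefore K lies in the submodule spanned by finitely many
elements of cker of that union, that is, in one cker (E 1 m). *)

Set Implicit Arguments.
Unset Strict Implicit.
Unset Printing Implicit Defensive.

Import GRing.Theory Num.Theory.

Local Open Scope group_scope.

(** * Words and free groups *)

Section Eval.
Variables (G : groupType) (X : choiceType).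
Implicit Types (f : X -> G) (u v w : word X).

Fixpoint eval f w : G :=
  if w is (x, b) :: w' then (if b then (f x)^-1 else f x) * eval f w' else 1.

Lemma eval_cat f u v : eval f (u ++ v) = eval f u * eval f v.
Proof. by elim: u => [|[x b] u IH] /=; rewrite ?mul1g // IH mulgA. Qed.

Lemma eval_winv f w : eval f (winv w) = (eval f w)^-1.
Proof.
elim: w => [|[x b] w IH]; first by rewrite invg1.
rewrite /winv /= rev_cons -cats1 eval_cat -/(winv w) IH /= mulg1 invgM.
by case: b; rewrite /= ?invgK.
Qed.

Lemma eval_pres_eq f (R : set (word X)) u v :
  (forall r, R r -> eval f r = 1) -> pres_eq R u v -> eval f u = eval f v.
Proof.
move=> fR; elim=> {u v} //.
- move=> u v x b; rewrite !eval_cat /= mulg1; congr (_ * _).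
  by case: b; rewrite /= ?mulgV ?mulVg mul1g.
- by move=> u v r /fR rE; rewrite !eval_cat rE mul1g.
- by move=> u v w _ -> _ ->.
Qed.

End Eval.

Lemma eval_class (X : choiceType) (R : set (word X)) (w : word X) :
  eval (fun x => pres_class R [:: (x, false)]) w = pres_class R w.
Proof.
elim: w => [|[x b] w IH] //=; rewrite IH.
have -> : pres_class R ((x, b) :: w) = pres_class R [:: (x, b)] * pres_class R w.
  by rewrite -[RHS]/(pres_mul _ _) pres_mulE.
congr (_ * _).
by case: b => //; rewrite -[LHS]/(pres_inv _) pres_invE.
Qed.

(** The map h is multiplicative on a subgroup P only; this is what the maps
defined on a subgroup of F, or by means of cosets, satisfy. *)
Lemma eval_hom (X : choiceType) (G G' : groupType) (P : G -> Prop) (h : G -> G')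
    (f : X -> G) (w : word X) :
  (forall x, P (f x)) -> P 1 -> (forall x, P x -> P x^-1) ->
  (forall x y, P x -> P y -> P (x * y)) ->
  (forall x y, P x -> P y -> h (x * y) = h x * h y) ->
  P (eval f w) /\ h (eval f w) = eval (fun x => h (f x)) w.
Proof.
move=> Pf P1 PV PM hM.
have h1 : h 1 = 1 by apply: (@mulgI _ (h 1)); rewrite -hM // !mulg1.
have hV x : P x -> h x^-1 = (h x)^-1.
  by move=> Px; apply: (@mulgI _ (h x)); rewrite -hM ?mulgV //; apply: PV.
elim: w => [|[x b] w [IH1 IH2]] //=.
have Px : P (if b then (f x)^-1 else f x) by case: b; auto.
by split; [apply: PM|rewrite hM // IH2; case: b {Px}; rewrite ?hV].
Qed.

(** The universal property of a free group in the form in which it is used: a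
family of permutations of any type T extends to an action on T.  Derivations,
paths in a coset graph and Magnus expansions are all read off from actions. *)
Record free_on (F : groupType) (X : choiceType) (i : X -> F) : Prop := {
  free_ind : forall P : F -> Prop, P 1 ->
    (forall x g, P g -> P (i x * g)) ->
    (forall x g, P g -> P ((i x)^-1 * g)) -> forall g, P g;
  free_act : forall (T : Type) (a b : X -> T -> T),
    (forall x, cancel (a x) (b x)) -> (forall x, cancel (b x) (a x)) ->
    exists act : F -> T -> T, [/\ forall t, act 1 t = t,
      forall g h t, act (g * h) t = act g (act h t) &
      forall x t, act (i x) t = a x t] }.

Lemma free_onP (F : groupType) : is_free F ->
  exists (X : choiceType) (i : X -> F), free_on i.
Proof.
case=> X [f [f' fK f'K]].
exists X, (fun x => f (pres_class set0 [:: (x, false)])).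
split=> [P P1 PM PV g|T a b abK baK].
  rewrite -[g]f'K -[f' g]pres_reprK; elim: (repr (f' g)) => [|[x c] w IH].
    by rewrite -[pres_class _ _]/(1 : free_group X) gmulf1.
  rewrite -cat1s -pres_mulE -[pres_mul _ _]/(_ * _ : free_group X) gmulfM.
  case: c; last exact: PM.
  have -> : pres_class set0 [:: (x, true)] =
    (pres_class set0 [:: (x, false)] : free_group X)^-1.
    by rewrite -[RHS]/(pres_inv _) pres_invE.
  by rewrite gmulfV; apply: PV.
pose wact w t := foldr (fun (l : X * bool) => if l.2 then b l.1 else a l.1) t w.
have wact_cat u v t : wact (u ++ v) t = wact u (wact v t).
  by rewrite /wact foldr_cat.
have wactP u v : pres_eq set0 u v -> wact u =1 wact v.
  elim=> {u v} //.
  - move=> u v x c t; rewrite !wact_cat; congr (wact u _).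
    by case: c => /=; rewrite ?abK ?baK.
  - by move=> u v _ IH t; rewrite IH.
  - by move=> u v w _ uv _ vw t; rewrite uv vw.
exists (fun g t => wact (repr (f' g)) t); split=> [t|g h t|x t].
- rewrite (can2_gmulf1 fK f'K) -[RHS]/(wact [::] t).
  exact/wactP/(pres_repr set0 [::]).
- rewrite (can2_gmulfM fK f'K) -wact_cat; exact/wactP/pres_repr.
- rewrite fK -[RHS]/(wact [:: (x, false)] t); exact/wactP/pres_repr.
Qed.

Local Open Scope ring_scope.

(** * Linear algebra modulo a subspace *)

Section LinearAlgebra.
Variables (k : fieldType) (V : lmodType k).
Implicit Types (W U : V -> Prop).

Record subspace W : Prop := {
  sub0 : W 0;
  subD : forall u v, W u -> W v -> W (u + v);
  subZ : forall c u, W u -> W (c *: u) }.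

Lemma subN W u : subspace W -> W u -> W (- u).
Proof. by move=> sW Wu; rewrite -scaleN1r; apply: subZ. Qed.

Lemma subB W u v : subspace W -> W u -> W v -> W (u - v).
Proof. by move=> sW Wu Wv; apply: subD => //; apply: subN. Qed.

Lemma sub_sum W I (r : seq I) (P : pred I) (f : I -> V) : subspace W ->
  (forall i, P i -> W (f i)) -> W (\sum_(i <- r | P i) f i).
Proof. by move=> sW Wf; elim/big_ind: _; [apply: sub0|apply: subD|]. Qed.

(** Quotients U / W of infinite dimensional spaces are handled through families
in U that are independent, or spanning, modulo W. *)
Definition indep W n (v : 'I_n -> V) :=
  forall c : 'I_n -> k, W (\sum_i c i *: v i) -> forall i, c i = 0.

Definition spans W U n (v : 'I_n -> V) :=
  (forall i, U (v i)) /\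
  forall u, U u -> exists c : 'I_n -> k, W (u - \sum_i c i *: v i).

Definition dim_le W U N :=
  forall m (v : 'I_m -> V), (forall i, U (v i)) -> indep W v -> (m <= N)%N.

Lemma spans_dim_le W U d (w : 'I_d -> V) : subspace W ->
  spans W U w -> dim_le W U d.
Proof.
move=> sW [Uw Sw] m v Uv vind; rewrite leqNgt; apply/negP => ltdm.
have /choice [A AP] i : exists c : 'I_d -> k, W (v i - \sum_j c j *: w j).
  exact/Sw/Uv.
pose M := \matrix_(i < m, j < d) A i j.
have /rowV0Pn [c /sub_kermxP cM cn0] : kermx M != 0.
  rewrite -mxrank_eq0 mxrank_ker subn_eq0 -ltnNge.
  exact: leq_ltn_trans (rank_leq_col M) ltdm.
case/eqP: cn0; apply/rowP => i; rewrite mxE; apply: (vind (c 0)).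
have -> : \sum_i c 0 i *: v i = \sum_i c 0 i *: (v i - \sum_j A i j *: w j).
  rewrite [RHS](eq_bigr (fun i => c 0 i *: v i - \sum_j (c 0 i * A i j) *: w j)).
    rewrite [RHS]sumrB -[LHS]subr0; congr (_ - _).
    rewrite exchange_big big1 //= => j _.
    rewrite -scaler_suml; move/rowP/(_ j): cM; rewrite !mxE => cM.
    by rewrite (eq_bigr (fun i => c 0 i * M i j)) ?cM ?scale0r // => l; rewrite mxE.
  move=> l _; rewrite scalerBr scaler_sumr; congr (_ - _).
  by apply: eq_bigr => j _; rewrite scalerA.
by apply: sub_sum => // l _; apply: subZ.
Qed.

(** An independent family of maximal size is spanning. *)
Lemma dim_le_basis W U N : subspace W -> dim_le W U N ->
  exists d (b : 'I_d -> V), spans W U b /\ indep W b.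
Proof.
move=> sW dimU.
pose P d := `[< exists b : 'I_d -> V, (forall i, U (b i)) /\ indep W b >].
have exP : exists d, P d.
  by exists 0%N; apply/asboolP; exists (fun=> 0); split=> [[]|c _ []].
have ubP d : P d -> (d <= N)%N by case/asboolP=> b [Ub bi]; apply: dimU bi.
case: (ex_maxnP exP ubP) => d /asboolP [b [Ub bi]] maxd.
exists d, b; split=> //; split=> // u Uu.
apply: contrapT => nu.
suff /maxd : P d.+1 by rewrite ltnn.
apply/asboolP; exists (fun i => oapp b u (unlift ord0 i)); split=> [i|c].
  by case: unliftP => [j _|_] //=.
rewrite big_ord_recl unlift_none /=.
under eq_bigr do rewrite liftK /=.
have [c0 Wc|c0 Wc] := eqVneq (c ord0) 0; last first.
  case: nu; exists (fun i => - (c ord0)^-1 * c (lift ord0 i)).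
  have := subZ sW (c ord0)^-1 Wc; rewrite scalerDr scalerA mulVf // scale1r.
  congr (W (_ + _)); rewrite -sumrN scaler_sumr; apply: eq_bigr => i _.
  by rewrite scalerA mulNr scaleNr opprK.
rewrite c0 scale0r add0r in Wc; move=> i.
by case: (unliftP ord0 i) => [j|] -> //; apply: (bi (fun j => c (lift ord0 j))).
Qed.

End LinearAlgebra.

(** * Vector spaces with a given basis *)

Section Lext.
Variables (k : fieldType) (T : choiceType) (V : lmodType k) (phi : T -> V).
Local Open Scope fset_scope.

Definition lext (u : {malg k[T]}) : V := \sum_(t <- msupp u) u@_t *: phi t.

Lemma lextEw (d : {fset T}) u :
  msupp u `<=` d -> lext u = \sum_(t <- d) u@_t *: phi t.
Proof.
move=> sd; apply: big_fset_incl => // t _ /mcoeff_outdom ->.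
by rewrite scale0r.
Qed.

Lemma lext_is_linear : linear lext.
Proof.
move=> c u v.
pose d := (msupp u `|` msupp v) `|` msupp (c *: u + v).
rewrite (@lextEw d (c *: u + v)) ?fsubsetUr //.
rewrite (@lextEw d u); last by rewrite /d -fsetUA fsubsetUl.
rewrite (@lextEw d v); last by rewrite /d fsetUAC fsubsetUr.
rewrite scaler_sumr -big_split /=; apply: eq_bigr => t _.
by rewrite mcoeffD mcoeffZ scalerDl scalerA.
Qed.

HB.instance Definition _ := GRing.isLinear.Build k {malg k[T]} V _ lext
  lext_is_linear.

Lemma lextU t : lext << t >> = phi t.
Proof. by rewrite (lextEw msuppU_le) big_seq_fset1 mcoeffUU scale1r. Qed.

End Lext.

Section FreeSpace.
Variables (k : fieldType).

Lemma malg_lin_ind (T : choiceType) (P : {malg k[T]} -> Prop) : P 0 ->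
  (forall c t u, P u -> P (c *: << t >> + u)) -> forall u, P u.
Proof.
move=> P0 PS u; rewrite (monalgE u); elim/big_rec: _ => // t v _ Pv.
suff -> : << u@_t *g t >> = u@_t *: (<< t >> : {malg k[T]}) by apply: PS.
by apply/malgP => s; rewrite mcoeffZ !mcoeffU mulrnAr mulr1.
Qed.

Lemma lin_ext (T : choiceType) (V : lmodType k) (f g : {linear {malg k[T]} -> V}) :
  (forall t, f << t >> = g << t >>) -> f =1 g.
Proof.
move=> fg; elim/malg_lin_ind => [|c t u IH]; first by rewrite !linear0.
by rewrite !linearP fg IH.
Qed.

Definition push (T T' : choiceType) (f : T -> T') : {malg k[T]} -> {malg k[T']} :=
  lext (fun t => << f t >>).

HB.instance Definition _ (T T' : choiceType) (f : T -> T') :=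
  GRing.isLinear.Build k {malg k[T]} {malg k[T']} _ (push f) (lext_is_linear _).

Lemma pushU (T T' : choiceType) (f : T -> T') t : push f << t >> = << f t >>.
Proof. exact: lextU. Qed.

Lemma lext_push (T T' : choiceType) (V : lmodType k) (f : T -> T') (phi : T' -> V) u :
  lext phi (push f u) = lext (phi \o f) u.
Proof.
by apply: (lin_ext (f := lext phi \o push f)) => t; rewrite /= pushU !lextU.
Qed.

Lemma push_push (T T' T'' : choiceType) (f : T -> T') (g : T' -> T'') u :
  push g (push f u) = push (g \o f) u.
Proof. exact: lext_push. Qed.

Lemma push_id (T : choiceType) (f : T -> T) u : f =1 id -> push f u = u.
Proof. by move=> fE; apply: (lin_ext (f := push f) (g := idfun)) => t; rewrite /= pushU fE. Qed.

Lemma eq_lext (T : choiceType) (V : lmodType k) (f g : T -> V) u : f =1 g -> lext f u = lext g u.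
Proof. by move=> /funext ->. Qed.

End FreeSpace.

(** * Coset kernels in a group algebra *)

Section Subgroups.
Variable F : groupType.
Implicit Types (E S : F -> Prop) (g h : F).

Record subgroup E : Prop := {
  sg1 : E 1%g;
  sgM : forall g h, E g -> E h -> E (g * h)%g;
  sgV : forall g, E g -> E (g^-1)%g }.

Inductive gen S : F -> Prop :=
| gen_in g : S g -> gen S g
| gen1 : gen S 1%g
| genM g h : gen S g -> gen S h -> gen S (g * h)%g
| genV g : gen S g -> gen S (g^-1)%g.

Lemma gen_subgroup S : subgroup (gen S).
Proof. by split; [apply: gen1|apply: genM|apply: genV]. Qed.

Lemma gen_min S E : subgroup E -> (forall g, S g -> E g) ->
  forall g, gen S g -> E g.
Proof.
move=> sE SE g; elim=> {g}; [by move=> g /SE|exact: sg1| |].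
- by move=> g h _ Eg _ Eh; apply: sgM.
- by move=> g _ Eg; apply: sgV.
Qed.

Lemma gen_mono S S' : (forall g, S g -> gen S' g) -> forall g, gen S g -> gen S' g.
Proof. by move=> SS; apply: gen_min => //; apply: gen_subgroup. Qed.

(** A choice of representatives of the left cosets gE.  The coset E itself is
represented by 1, so that the path of an element of E in the coset graph starts
and ends at 1. *)
Definition rep E g : F :=
  if `[< E g >] then 1%g else choose (fun h => `[< E (h^-1 * g)%g >]) g.

Lemma rep1 E : subgroup E -> rep E 1%g = 1%g.
Proof. by move=> sE; rewrite /rep asboolT //; apply: sg1. Qed.

Lemma repP E g : subgroup E -> E ((rep E g)^-1 * g)%g.
Proof.
move=> sE; rewrite /rep; case: asboolP => [Eg|_]; first by rewrite invg1 mul1g.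
apply/asboolP; apply: (@chooseP _ (fun h => `[< E (h^-1 * g)%g >]) g).
by apply/asboolP; rewrite mulVg; apply: sg1.
Qed.

Lemma rep_mem E g : subgroup E -> E g -> rep E g = 1%g.
Proof. by move=> sE Eg; rewrite /rep asboolT. Qed.

Lemma rep_eq E g h : subgroup E -> rep E g = rep E h <-> E (g^-1 * h)%g.
Proof.
move=> sE; split=> [rgh|Egh].
  have := sgM sE (sgV sE (repP g sE)) (repP h sE).
  by rewrite rgh invgM invgK -mulgA mulVKg.
have Ehg : E (h^-1 * g)%g by have := sgV sE Egh; rewrite invgM invgK.
rewrite /rep; have -> : `[< E g >] = `[< E h >].
  apply/asbool_equiv_eq; split=> Ex.
    by rewrite -[h](mulVKg g); apply: sgM.
  by rewrite -[g](mulVKg h); apply: sgM.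
case: asboolP => // _.
have -> : (fun l => `[< E (l^-1 * g)%g >]) = (fun l => `[< E (l^-1 * h)%g >]).
  apply/funext => l; apply/asbool_equiv_eq; split=> Ex.
    by rewrite -[h](mulVKg g) mulgA; apply: sgM.
  by rewrite -[g](mulVKg h) mulgA; apply: sgM.
by apply: choose_id; apply/asboolP; rewrite ?mulVg //; apply: sg1.
Qed.

Lemma rep_rep E g h : subgroup E -> rep E (g * rep E h)%g = rep E (g * h)%g.
Proof.
by move=> sE; apply/rep_eq => //; rewrite invgM -mulgA mulKg; apply: repP.
Qed.

Lemma rep_id E g : subgroup E -> rep E (rep E g) = rep E g.
Proof. by move=> sE; have := rep_rep 1%g g sE; rewrite !mul1g. Qed.

Lemma rep_mulr E g e : subgroup E -> E e -> rep E (g * e)%g = rep E g.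
Proof.
move=> sE Ee; apply/rep_eq => //; rewrite invgM -mulgA mulVg mulg1.
exact: sgV.
Qed.

End Subgroups.

Section GroupAlgebra.
Variables (k : fieldType) (F : groupType).
Implicit Types (E : F -> Prop) (g h : F) (u v : {malg k[F]}).
Implicit Types (U : {malg k[F]} -> Prop).

Definition gact g : {malg k[F]} -> {malg k[F]} := push (fun h => (g * h)%g).
HB.instance Definition _ g :=
  GRing.isLinear.Build k {malg k[F]} {malg k[F]} _ (gact g) (lext_is_linear _).

Lemma gactU g h : gact g << h >> = << (g * h)%g >>.
Proof. exact: pushU. Qed.

Lemma gactM g h u : gact (g * h)%g u = gact g (gact h u).
Proof.
by rewrite /gact push_push; apply: eq_lext => l /=; rewrite mulgA.
Qed.

Lemma gact1 u : gact 1%g u = u.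
Proof. by apply: push_id => g; rewrite mul1g. Qed.

Record submodule U : Prop := {
  smS :> subspace U;
  smT : forall g u, U u -> U (gact g u) }.

(** This is I U, for the augmentation ideal I of k[F]. *)
Inductive aug U : {malg k[F]} -> Prop :=
| aug0 : aug U 0
| augS h v u : U v -> aug U u -> aug U (gact h v - v + u).

Lemma aug_subspace U : subspace U -> subspace (aug U).
Proof.
move=> sU; split; first exact: aug0.
  move=> u v; elim=> {u} [|h w u Uw _ IH] av; first by rewrite add0r.
  by rewrite -addrA; apply: augS => //; apply: IH.
move=> c u; elim=> {u} [|h w u Uw _ IH]; first by rewrite scaler0; apply: aug0.
rewrite scalerDr scalerBr -linearZ; apply: augS => //; exact: subZ.
Qed.

Lemma aug_gen U h v : U v -> aug U (gact h v - v).
Proof. by move=> Uv; rewrite -[X in aug _ X]addr0; apply/augS/aug0. Qed.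

(** The element h' allows f to be semilinear with respect to an endomorphism
of F. *)
Lemma aug_image U U' (f : {linear {malg k[F]} -> {malg k[F]}}) u :
  (forall v, U v -> U' (f v)) ->
  (forall h v, U v -> exists h', f (gact h v) = gact h' (f v)) ->
  aug U u -> aug U' (f u).
Proof.
move=> fU fT; elim=> {u} [|h v u Uv _ IH]; first by rewrite linear0; apply: aug0.
have [h' E] := fT h v Uv.
by rewrite linearD linearB E; apply: augS => //; apply: fU.
Qed.

Lemma aug_mono U U' u : (forall v, U v -> U' v) -> aug U u -> aug U' u.
Proof.
by move=> UU'; elim=> {u} [|h v u /UU' Uv _ IH]; [apply: aug0|apply: augS].
Qed.

(** The kernel of k[F] -> k[F/E], where k[F/E] is realized inside k[F] by means
of the representatives of the cosets. *)
Variant cker E u : Prop := in_cker of push (rep E) u = 0.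

Lemma cker_submodule E : subgroup E -> submodule (cker E).
Proof.
move=> sE; split; [split=> [|u v [Ju] [Jv]|c u [Ju]]|move=> g u [Ju]]; apply: in_cker.
- exact: linear0.
- by rewrite linearD /= Ju Jv addr0.
- by rewrite linearZ /= Ju scaler0.
rewrite /gact push_push.
have -> : push (rep E \o (fun h => (g * h)%g)) u =
          push (rep E \o (fun h => (g * h)%g)) (push (rep E) u).
  by rewrite push_push; apply: eq_lext => h /=; rewrite rep_rep.
by rewrite Ju linear0.
Qed.

Lemma cker_subspace E : subgroup E -> subspace (cker E).
Proof. by move=> sE; apply/smS/cker_submodule. Qed.

Lemma cker_gen E g e : subgroup E -> E e -> cker E (<< (g * e)%g >> - << g >>).
Proof. by move=> sE Ee; apply: in_cker; rewrite linearB /= !pushU rep_mulr // subrr. Qed.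

(** Modulo the elements ge - g, every element of k[F] is congruent to a
combination of coset representatives. *)
Lemma cker_ind E (P : {malg k[F]} -> Prop) : subgroup E -> subspace P ->
  (forall g e, E e -> P (<< (g * e)%g >> - << g >>)) -> forall u, cker E u -> P u.
Proof.
move=> sE sP PJ u [Ju]; rewrite -[u]subr0 -Ju.
elim/malg_lin_ind: u {Ju} => [|c g u IH]; first by rewrite linear0 subr0; apply: sub0.
rewrite linearP /= pushU opprD addrACA -scalerBr; apply: subD => //.
apply: subZ => //; rewrite -opprB; apply: subN => //.
rewrite -[X in << X >> - _](mulVKg g); apply: PJ.
by have := sgV sE (repP g sE); rewrite invgM invgK.
Qed.

Lemma cker_mono E E' u : subgroup E -> subgroup E' -> (forall g, E g -> E' g) ->
  cker E u -> cker E' u.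
Proof.
move=> sE sE' EE'; apply: cker_ind => //; first exact: cker_subspace.
by move=> g e /EE' E'e; apply: cker_gen.
Qed.

(** If s = ab then gs - g = (gab - ga) + (ga - g): the elements s for which
gs - g lies in cker E1 + cker E2 for all g form a subgroup. *)
Lemma cker_join (E1 E2 E : F -> Prop) : subgroup E1 -> subgroup E2 -> subgroup E ->
  (forall g, E g -> gen (fun h => E1 h \/ E2 h) g) -> forall u, cker E u ->
  exists u1 u2, [/\ cker E1 u1, cker E2 u2 & u = u1 + u2].
Proof.
move=> s1 s2 sE EE.
pose P u := exists u1 u2, [/\ cker E1 u1, cker E2 u2 & u = u1 + u2].
have m1 := cker_subspace s1; have m2 := cker_subspace s2.
have sP : subspace P.
  split.
  - by exists 0, 0; split; rewrite ?addr0 //; apply: sub0.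
  - move=> _ _ [u1 [u2 [J1 J2 ->]]] [v1 [v2 [J1' J2' ->]]].
    by exists (u1 + v1), (u2 + v2); rewrite addrACA; split=> //; apply: subD.
  - move=> c _ [u1 [u2 [J1 J2 ->]]]; exists (c *: u1), (c *: u2).
    by rewrite scalerDr; split=> //; apply: subZ.
apply: (cker_ind (P := P)) => // g e /EE Ee; elim: Ee g => {e}.
- move=> e [Ee|Ee] g; [exists (<< (g * e)%g >> - << g >>), 0|
    exists 0, (<< (g * e)%g >> - << g >>)]; rewrite ?addr0 ?add0r.
  by split=> //; [apply: cker_gen|apply: (sub0 m2)].
  by split=> //; [apply: (sub0 m1)|apply: cker_gen].
- by move=> g; rewrite mulg1 subrr; exact: (sub0 sP).
- move=> e e' _ IH _ IH' g; have := subD sP (IH g) (IH' (g * e)%g).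
  by rewrite mulgA addrC subrKA.
- move=> e _ IH g; have := subN sP (IH (g * e^-1)%g).
  by rewrite opprB mulgVK.
Qed.

Lemma cker_push (Psi : F -> F) E E' u : subgroup E -> subgroup E' ->
  (forall g h, Psi (g * h)%g = (Psi g * Psi h)%g) ->
  (forall g, E g -> E' (Psi g)) -> cker E u -> cker E' (push Psi u).
Proof.
move=> sE sE' PsiM EE'; apply: (cker_ind (P := fun u => cker E' (push Psi u)) sE).
  have mE' := cker_subspace sE'; split=> [|u1 u2|c u1]; rewrite ?linear0 ?linearD ?linearZ.
  - exact: sub0.
  - exact: subD.
  - exact: subZ.
by move=> g e Ee; rewrite linearB /= !pushU PsiM; apply: cker_gen; auto.
Qed.

(** The space k[F * Y] is the free k[F]-module on Y, and gen_map b is the linear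
map that sends the basis element y to b y. *)
Definition gactY (Y : choiceType) g : {malg k[(F * Y)%type]} -> {malg k[(F * Y)%type]} :=
  push (fun p => ((g * p.1)%g, p.2)).
HB.instance Definition _ (Y : choiceType) g :=
  GRing.isLinear.Build k {malg k[(F * Y)%type]} {malg k[(F * Y)%type]} _ (@gactY Y g) (lext_is_linear _).

Definition gen_map (Y : choiceType) (b : Y -> {malg k[F]}) : {malg k[(F * Y)%type]} -> {malg k[F]} :=
  lext (fun p => gact p.1 (b p.2)).
HB.instance Definition _ (Y : choiceType) (b : Y -> {malg k[F]}) :=
  GRing.isLinear.Build k {malg k[(F * Y)%type]} {malg k[F]} _ (gen_map b) (lext_is_linear _).

Lemma gen_map_gactY (Y : choiceType) (b : Y -> {malg k[F]}) g (u : {malg k[(F * Y)%type]}) : gen_map b (gactY g u) = gact g (gen_map b u).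
Proof.
apply: (lin_ext (f := gen_map b \o gactY g) (g := gact g \o gen_map b)) => -[h y] /=.
by rewrite /gactY /gen_map pushU !lextU /= gactM.
Qed.

(** The ideal cker E is projective: the section s is a Fox derivative relative
to E.  The free module has one generator for each edge (x, c) of the Schreier
graph of the cosets of E, sent to xc - rep(xc).  The derivation D adds up the
edges of a path, D(xg) = x D(g) + [x, rep g], and an induction on g shows that
D(g) is sent to g - rep g; the linear extension of D is thus a section over
cker E, where it is equivariant because D(ge) = D(g) + g D(e) for e in E. *)
Lemma cker_projective (X : choiceType) (i : X -> F) E : free_on i -> subgroup E ->
  exists (Y : choiceType) (b : Y -> {malg k[F]})
    (s : {linear {malg k[F]} -> {malg k[(F * Y)%type]}}),
  [/\ forall y, cker E (b y), forall u, cker E u -> gen_map b (s u) = u &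
      forall g u, cker E u -> s (gact g u) = gactY g (s u)].
Proof.
move=> free_i sE.
pose Y : choiceType := (X * F)%type.
pose A := {malg k[(F * Y)%type]}.
pose b (y : Y) : {malg k[F]} :=
  << (i y.1 * y.2)%g >> - << rep E (i y.1 * y.2)%g >>.
pose st (x : X) (g : F) : {malg k[(F * Y)%type]} := << (1%g, (x, rep E g)) >>.
(* F acts on pairs (v, g); the first component of the image of (0, 1) under g
   is D(g), the second one keeps track of the current vertex *)
pose up x (p : A * F) : A * F := (gactY (i x) p.1 + st x p.2, (i x * p.2)%g).
pose dn x (p : A * F) : A * F :=
  (gactY (i x)^-1%g (p.1 - st x ((i x)^-1 * p.2)%g), ((i x)^-1 * p.2)%g).
have trYM g h (u : {malg k[(F * Y)%type]}) : @gactY Y (g * h)%g u = gactY g (gactY h u).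
  by rewrite /gactY push_push; apply: eq_lext => l /=; rewrite mulgA.
have trY1 (u : {malg k[(F * Y)%type]}) : @gactY Y 1%g u = u by apply: push_id => -[g y]; rewrite mul1g.
have updn x : cancel (up x) (dn x).
  by case=> v g; rewrite /up /dn /= mulKg addrK -trYM mulVg trY1.
have dnup x : cancel (dn x) (up x).
  by case=> v g; rewrite /up /dn /= mulVKg -trYM mulgV trY1 subrK.
have [act [act1 actM actX]] := free_act (T := A * F) free_i updn dnup.
have actV x p : act (i x)^-1%g p = dn x p.
  by rewrite -[act _ p](updn x) -actX -actM mulgV act1.
have act2 g p : (act g p).2 = (g * p.2)%g.
  elim/(free_ind free_i): g p => [|x g IH|x g IH] p.
  - by rewrite act1 mul1g.
  - by rewrite actM actX /= IH mulgA.
  - by rewrite actM actV /= IH mulgA.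
have stE x g e : E e -> st x (g * e)%g = st x g.
  by move=> Ee; rewrite /st (rep_mulr _ sE Ee).
have actD g e (v v' : A) t : E e ->
    (act g (v, (t * e)%g)).1 = (act g (v', t)).1 + gactY g (v - v').
  move=> Ee; elim/(free_ind free_i): g => [|x g IH|x g IH].
  - by rewrite !act1 trY1 /= addrC subrK.
  - rewrite !actM !actX /= IH !act2 /= trYM linearD /= -!addrA; congr (_ + _).
    rewrite mulgA (stE _ _ _ Ee) addrC; reflexivity.
  - rewrite !actM !actV /= IH !act2 /= trYM -linearD /=; congr (gactY _ _).
    by rewrite !mulgA (stE _ _ _ Ee) addrAC.
pose D g := (act g (0, 1%g)).1.
have DE g e : E e -> D (g * e)%g = D g + gactY g (D e).
  move=> Ee; rewrite /D actM [act e _]surjective_pairing act2 /= mulg1.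
  rewrite -{2}[e]mul1g (actD g e _ 0); last exact: Ee.
  rewrite subr0; reflexivity.
have bD g : gen_map b (D g) = << g >> - << rep E g >>.
  rewrite /D; elim/(free_ind free_i): g => [|x g IH|x g IH].
  - by rewrite act1 /= linear0 rep1 // subrr.
  - rewrite actM actX /= act2 /= mulg1 linearD /= gen_map_gactY IH linearB /= !gactU.
    by rewrite /gen_map lextU /= gact1 /b /= rep_rep // subrKA.
  - rewrite actM actV /= act2 /= mulg1 gen_map_gactY linearB /= IH.
    rewrite /gen_map lextU /= gact1 /b /= rep_rep // mulVKg.
    by rewrite opprB addrA subrK linearB /= !gactU mulKg.
exists Y, b, (lext D); split.
- by move=> y; apply: in_cker; rewrite linearB /= !pushU rep_id // subrr.
- move=> u [Ju]; have : gen_map b (lext D u) = u - push (rep E) u.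
    apply: (lin_ext (f := gen_map b \o lext D) (g := idfun \- push (rep E))) => g /=.
    by rewrite lextU bD pushU.
  by rewrite Ju subr0.
- move=> g u; apply: (cker_ind (P := fun u => lext D (gact g u) = gactY g (lext D u)) sE).
    have L0 : lext D 0 = 0 := linear0 _; have t0 : gact g 0 = 0 := linear0 _.
    have y0 : @gactY Y g 0 = 0 := linear0 _.
    have LD (u1 u2 : {malg k[F]}) : lext D (u1 + u2) = lext D u1 + lext D u2 := linearD _ _ _.
    have tD (u1 u2 : {malg k[F]}) : gact g (u1 + u2) = gact g u1 + gact g u2 := linearD _ _ _.
    have yD (u1 u2 : A) : @gactY Y g (u1 + u2) = gactY g u1 + gactY g u2 := linearD _ _ _.
    have LZ c (u1 : {malg k[F]}) : lext D (c *: u1) = c *: lext D u1 := linearZ_LR _ _ _.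
    have tZ c (u1 : {malg k[F]}) : gact g (c *: u1) = c *: gact g u1 := linearZ_LR _ _ _.
    have yZ c (u1 : A) : @gactY Y g (c *: u1) = c *: gactY g u1 := linearZ_LR _ _ _.
    split=> [|u1 u2 h1 h2|c u1 h1].
    - by rewrite t0 L0 y0; reflexivity.
    - by rewrite tD !LD yD h1 h2; reflexivity.
    - by rewrite tZ !LZ yZ h1; reflexivity.
  have LB (u1 u2 : {malg k[F]}) : lext D (u1 - u2) = lext D u1 - lext D u2 := linearB _ _ _.
  have tB (u1 u2 : {malg k[F]}) : gact g (u1 - u2) = gact g u1 - gact g u2 := linearB _ _ _.
  have DB h e : E e -> D (h * e)%g - D h = gactY h (D e).
    by move=> Ee; rewrite (DE _ _ Ee) [D h + _]addrC addrK; reflexivity.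
  move=> h e Ee; rewrite tB !LB !gactU !lextU mulgA (DB _ _ Ee) (DB _ _ Ee) trYM.
  reflexivity.
Qed.

End GroupAlgebra.

(** * Polynomial functions and the powers of the augmentation ideal *)

Section Polynomial.
Variable F : groupType.
Implicit Types (f : F -> rat) (g h : F).

(** The polynomial functions of degree less than d are those whose linear
extension to k[F] vanishes on the d-th power of the augmentation ideal. *)
Fixpoint deg_lt d f : Prop :=
  if d is d'.+1 then forall h, deg_lt d' (fun g => f (h * g)%g - f g)
  else forall g, f g = 0.

Lemma eq_deg_lt d f f' : f =1 f' -> deg_lt d f -> deg_lt d f'.
Proof. by move=> /funext ->. Qed.

Lemma deg_lt0 d f : (forall g, f g = 0) -> deg_lt d f.
Proof.
elim: d f => [|d IH] f f0 //= h; apply: IH => g.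
by rewrite !f0 subrr.
Qed.

Lemma deg_ltS d f : deg_lt d f -> deg_lt d.+1 f.
Proof.
elim: d f => [|d IH] f pf; first by apply: deg_lt0.
by move=> h; apply: IH; apply: pf.
Qed.

Lemma deg_lt_le d e f : (d <= e)%N -> deg_lt d f -> deg_lt e f.
Proof.
move=> /subnK <-; elim: (e - d)%N => [|n IH] // pf.
by rewrite addSn; apply: deg_ltS; apply: IH.
Qed.

Lemma deg_lt_const c : deg_lt 1 (fun=> c).
Proof. by move=> h g; rewrite subrr. Qed.

Lemma deg_ltD d f f' : deg_lt d f -> deg_lt d f' -> deg_lt d (fun g => f g + f' g).
Proof.
elim: d f f' => [|d IH] f f' pf pf'; first by move=> g; rewrite pf pf' addr0.
move=> h; apply: eq_deg_lt (IH _ _ (pf h) (pf' h)) => g.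
by rewrite opprD addrACA.
Qed.

Lemma deg_ltZ d c f : deg_lt d f -> deg_lt d (fun g => c * f g).
Proof.
elim: d f => [|d IH] f pf; first by move=> g; rewrite pf mulr0.
by move=> h; apply: eq_deg_lt (IH _ (pf h)) => g; rewrite mulrBr.
Qed.

(** The difference operator satisfies
D(f f') = Df f' + f Df' + Df Df', where each term has lower total degree. *)
Lemma deg_ltM d e f f' : deg_lt d f -> deg_lt e f' -> deg_lt (d + e) (fun g => f g * f' g).
Proof.
have [n] := ubnP (d + e); elim: n d e f f' => // n IH [|d] e f f' ltn pf pf'.
  by apply: deg_lt0 => g; rewrite pf mul0r.
case: e pf' ltn => [|e] pf' ltn; first by apply: deg_lt0 => g; rewrite pf' mulr0.
rewrite addSn => h.
have p1 : deg_lt (d + e.+1) (fun g => (f (h * g)%g - f g) * f' g).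
  by apply: IH; [lia|exact: pf|exact: pf'].
have p2 : deg_lt (d + e.+1) (fun g => f g * (f' (h * g)%g - f' g)).
  by rewrite addnS -addSn; apply: IH; [lia|exact: pf|exact: pf'].
have p3 : deg_lt (d + e.+1) (fun g => (f (h * g)%g - f g) * (f' (h * g)%g - f' g)).
  by rewrite addnS; apply: deg_ltS; apply: IH; [lia|exact: pf|exact: pf'].
by apply: eq_deg_lt (deg_ltD (deg_ltD p1 p2) p3) => g; ring.
Qed.

Lemma deg_lt_tr d f h : deg_lt d f -> deg_lt d (fun g => f (g * h)%g).
Proof.
elim: d f => [|d IH] f pf; first by move=> g; apply: pf.
by move=> l; apply: eq_deg_lt (IH _ (pf l)) => g; rewrite mulgA.
Qed.

Definition polynomial f := exists d, deg_lt d f.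

(** If B = I B then B is contained in all the powers of I. *)
Lemma poly_aug (B : {malg rat[F]} -> Prop) f : (forall b, B b -> aug B b) ->
  polynomial f -> forall b, B b -> lext (V := rat^o) f b = 0.
Proof.
move=> Baug [d]; elim: d f => [|d IH] f pf b Bb.
  by rewrite /lext big1 // => g _; rewrite pf scaler0.
elim: {b Bb}(Baug b Bb) => [|h v u Bv _ IHu]; first exact: linear0.
have LD (u1 u2 : {malg rat[F]}) : lext (V := rat^o) f (u1 + u2) =
  lext (V := rat^o) f u1 + lext (V := rat^o) f u2 := linearD _ _ _.
have LB (u1 u2 : {malg rat[F]}) : lext (V := rat^o) f (u1 - u2) =
  lext (V := rat^o) f u1 - lext (V := rat^o) f u2 := linearB _ _ _.
rewrite LD IHu addr0 LB /gact lext_push -[RHS](IH _ (pf h) _ Bv).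
rewrite /lext -sumrB; apply: eq_bigr => g _ /=.
by rewrite -scalerBr.
Qed.

Hypothesis poly_separates : forall g : F, g != 1%g ->
  exists f, polynomial f /\ f g != f 1%g.

(** A product of polynomial functions, each vanishing at one element of s. *)
Lemma poly_delta g (s : seq F) : g \notin s ->
  exists f, [/\ polynomial f, f g != 0 & forall h, h \in s -> f h = 0].
Proof.
elim: s => [|h s IH]; first by move=> _; exists (fun=> 1); split=> //; exists 1%N; apply: deg_lt_const.
rewrite inE negb_or => /andP [gh /IH [f [[d pf] fg fs]]].
have [|f' [[d' pf'] f'g]] := poly_separates (g := (g * h^-1)%g); first by rewrite divg_eq1.
exists (fun x => f x * (f' (x * h^-1)%g + - f' 1%g)); split.
- exists (d + (d' + 1))%N; apply: deg_ltM => //; apply: deg_ltD.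
    by apply: deg_lt_le (deg_lt_tr _ pf'); rewrite leq_addr.
  by apply: deg_lt_le (deg_lt_const _); rewrite leq_addl.
- by rewrite mulf_neq0 // subr_eq0.
- move=> x; rewrite inE => /predU1P [->|xs]; first by rewrite mulgV subrr mulr0.
  by rewrite fs // mul0r.
Qed.

(** This is a form of the residual nilpotence of k[F]. *)
Lemma aug_eq0 (B : {malg rat[F]} -> Prop) : (forall b, B b -> aug B b) ->
  forall b, B b -> b = 0.
Proof.
move=> Baug b Bb; apply/malgP => g; rewrite mcoeff0.
have [|f [fp fg fs]] := poly_delta (g := g) (s := [seq h <- msupp b | h != g]).
  by rewrite mem_filter eqxx.
have := poly_aug Baug fp Bb; have [gb|/mcoeff_outdom //] := boolP (g \in msupp b).
rewrite /lext (big_fsetD1 g) //= big_seq big1 => [|h]; last first.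
  rewrite in_fsetD1 => /andP [hg hb]; rewrite fs ?scaler0 // mem_filter hg.
  exact: hb.
by move/eqP; rewrite addr0 mulf_eq0 (negPf fg) orbF => /eqP.
Qed.
End Polynomial.

(** * Magnus expansion *)

Section Magnus.
Variables (F : groupType) (X : choiceType) (i : X -> F).
Hypothesis free_i : free_on i.
Implicit Types (c : seq X -> rat) (w : seq X) (x y : X) (g h : F).

(** A function c on seq X stands for a power series in noncommuting variables;
these are the left multiplications by 1 + x and by its inverse. *)
Definition mul1X x c w : rat :=
  c w + (if w is y :: w' then if y == x then c w' else 0 else 0).

Fixpoint div1X x c w : rat :=
  c w - (if w is y :: w' then if y == x then div1X x c w' else 0 else 0).

Lemma mul1XK x : cancel (mul1X x) (div1X x).
Proof.
move=> c; apply/funext; elim=> [|y w IH] /=; first by rewrite /mul1X addr0 subr0.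
by rewrite IH /mul1X; case: eqP; rewrite ?addrK ?addr0 ?subr0.
Qed.

Lemma div1XK x : cancel (div1X x) (mul1X x).
Proof.
move=> c; apply/funext => -[|y w]; first by rewrite /mul1X /= subr0 addr0.
by rewrite /mul1X /= subrK.
Qed.

(** Each coefficient of the Magnus expansion is a polynomial function.  If
g = x_1^e_1 ... x_n^e_n with e_j <> 0 and x_j <> x_(j+1), the coefficient of
x_1 ... x_n in the expansion of g is e_1 ... e_n, whereas it is 0 for 1. *)
Lemma magnus_separates g : g != 1%g -> exists f, polynomial f /\ f g != f 1%g.
Proof.
have [act [act1 actM actX]] := free_act free_i mul1XK div1XK.
have actV x c : act (i x)^-1%g c = div1X x c.
  by rewrite -[act _ c](mul1XK x) -actX -actM mulgV act1.
(* The action of h is unipotent: it changes the coefficient of w by a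
   combination of the coefficients of the proper suffixes of w. *)
have unip h w : exists s : seq (rat * seq X),
    (forall p, p \in s -> (size p.2 < size w)%N) /\
    forall c, act h c w = c w + \sum_(p <- s) p.1 * c p.2.
  elim/(free_ind free_i): h w => [|x h IH|x h IH] w.
  - by exists [::]; split=> // c; rewrite act1 big_nil addr0.
  - have [s [ss sE]] := IH w; case: w ss sE => [|y w] ss sE.
      by exists s; split=> // c; rewrite actM actX /mul1X addr0 sE.
    have [yx|yx] := eqVneq y x; last first.
      by exists s; split=> // c; rewrite actM actX /mul1X (negPf yx) addr0 sE.
    subst y; have [s' [ss' sE']] := IH w; exists (s ++ (1, w) :: s'); split=> [p|c].
      rewrite mem_cat inE => /or3P [/ss //|/eqP -> //|/ss' /= sp].
      exact: ltnW.
    rewrite actM actX /mul1X eqxx sE sE' big_cat big_cons /= mul1r; ring.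
  - elim: w => [|y w [s' [ss' sE']]].
      have [s [ss sE]] := IH [::].
      by exists s; split=> // c; rewrite actM actV /= subr0 sE.
    have [s [ss sE]] := IH (y :: w).
    have [yx|yx] := eqVneq y x; last first.
      by exists s; split=> // c; rewrite actM actV /= (negPf yx) subr0 sE.
    subst y; exists (s ++ (-1, w) :: [seq (- p.1, p.2) | p <- s']); split=> [p|c].
      rewrite mem_cat inE => /or3P [/ss //|/eqP -> //|/mapP [q /ss' qs -> /=]].
      exact: ltnW.
    have := sE' c; rewrite !actM !actV /= eqxx => ->.
    rewrite sE big_cat big_cons /= big_map /=.
    under [X in _ + (_ + (_ + X))]eq_bigr do rewrite mulNr.
    by rewrite sumrN; ring.
have polact n c w : (size w < n)%N -> deg_lt n (fun g => act g c w).
  elim: n w => // n IH w wn h.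
  have [s [ss sE]] := unip h w.
  have {}ss p : p \in s -> (size p.2 < n)%N by move=> /ss /leq_trans; apply.
  have := eq_deg_lt (f := fun g => \sum_(p <- s) p.1 * act g c p.2); apply.
    by move=> l; rewrite actM sE addrC addKr.
  elim: s ss {sE} => [|p s IHs] ss; first by apply: deg_lt0 => l; rewrite big_nil.
  have := eq_deg_lt (f := fun g => p.1 * act g c p.2 + \sum_(q <- s) q.1 * act g c q.2).
  apply; first by move=> l; rewrite big_cons.
  apply: deg_ltD; first by apply/deg_ltZ/IH/ss; rewrite mem_head.
  by apply: IHs => q qs; apply: ss; rewrite inE qs orbT.
pose powz (l : F) (z : int) :=
  match z with Posz n => (l ^+ n)%g | Negz n => (l ^- n.+1)%g end.
have powzS l z : (l * powz l z = powz l (1 + z))%g.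
  case: z => [n|n] /=; first by rewrite -expgS.
  case: n => [|n]; first by rewrite /= expg1 mulgV.
  have -> : 1 + Negz n.+1 = Negz n by rewrite !NegzE; lia.
  by rewrite /= expgSr invgM mulVKg.
have powzP l z : (l^-1 * powz l z = powz l (z - 1))%g.
  by rewrite -[z in LHS](subrK 1) [_ - 1 + 1]addrC -powzS mulKg.
(* the words before which a syllable in x can be put *)
pose ok x w := ohead w != Some x.
have powzE x e c w : ok x w ->
    act (powz (i x) e) c (x :: w) = c (x :: w) + e%:~R * c w /\
    act (powz (i x) e) c w = c w.
  move=> okw.
  have mulw d : mul1X x d w = d w.
    rewrite /mul1X; case: w okw => [|y w]; rewrite /ok /= ?addr0 //.
    by rewrite (inj_eq (@Some_inj _)) => /negPf ->; rewrite addr0.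
  have divw d : div1X x d w = d w.
    case: w okw {mulw} => [|y w]; rewrite /ok /= ?subr0 //.
    by rewrite (inj_eq (@Some_inj _)) => /negPf ->; rewrite subr0.
  have pos n : act (i x ^+ n)%g c (x :: w) = c (x :: w) + n%:R * c w /\
      act (i x ^+ n)%g c w = c w.
    elim: n => [|n [IH1 IH2]]; first by rewrite act1 mul0r addr0.
    rewrite expgS actM actX mulw IH2 /mul1X eqxx IH1 IH2 -natr1; split=> //; ring.
  case: e => n; first exact: pos.
  have neg m : act (i x ^- m)%g c (x :: w) = c (x :: w) - m%:R * c w /\
      act (i x ^- m)%g c w = c w.
    elim: m => [|m [IH1 IH2]]; first by rewrite invg1 act1 mul0r subr0.
    rewrite expgSr invgM actM actV divw IH2 /= eqxx divw IH1 IH2 -natr1.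
    by split=> //; ring.
  have [-> ->] := neg n.+1; split=> //.
  by rewrite NegzE mulrNz mulNr.
(* w is the word of the letters x_1 ... x_n of a normal form of g *)
pose nf := fix nf w g : Prop :=
  if w is x :: w' then exists e h, [/\ e != 0, ok x w', nf w' h &
    g = (powz (i x) e * h)%g] else g = 1%g.
have nf_step x (d : int) l : d != 0 ->
    (forall z, (l * powz (i x) z)%g = powz (i x) (d + z)) ->
    forall h, (exists w, nf w h) -> exists w, nf w (l * h)%g.
  move=> d0 lE h [w wh].
  have lE1 : l = powz (i x) d by have := lE 0; rewrite addr0 /= mulg1.
  have new : ok x w -> exists w, nf w (l * h)%g.
    by move=> okw; exists (x :: w), d, h; rewrite -lE1.
  case: w wh new => [|y w] wh new; first exact: new.
  have [yx|yx] := eqVneq y x; last first.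
    by apply: new; rewrite /ok /= (inj_eq (@Some_inj _)).
  subst y; case: wh => e [h' [e0 okw wh ->]]; rewrite mulgA lE.
  have [->|de0] := eqVneq (d + e) 0; first by exists w; rewrite mul1g.
  by exists (x :: w), (d + e), h'.
have nfP h : exists w, nf w h.
  elim/(free_ind free_i): h => [|x h IH|x h IH]; first by exists [::].
    exact: (nf_step x 1).
  by apply: (nf_step x (-1)) => // z; rewrite powzP addrC.
pose alt := fix alt w := if w is x :: w' then ok x w' && alt w' else true.
pose dl w : rat := (w == [::])%:R.
have nf_act w h : nf w h -> [/\ alt w, act h dl w != 0 &
    forall v, alt v -> (size w < size v)%N -> act h dl v = 0].
  elim: w h => [|x w IH] h /=.
    by move=> ->; rewrite act1; split=> // -[|y v].
  case=> e [h' [e0 okw /IH [aw hw hv] ->]]; rewrite okw aw; split=> //.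
    rewrite actM; have [-> _] := powzE x e (act h' dl) w okw.
    by rewrite hv ?add0r ?mulf_neq0 ?intr_eq0 //= okw.
  case=> // y v av sv; rewrite actM.
  have [yx|yx] := eqVneq y x.
    subst y; case/andP: (av) => okv av'.
    have [-> _] := powzE x e (act h' dl) v okv.
    rewrite (hv (x :: v)) ?(hv v) ?mulr0 ?addr0 //; first exact: ltnW.
  have okv : ok x (y :: v) by rewrite /ok /= (inj_eq (@Some_inj _)).
  have [_ ->] := powzE x e (act h' dl) (y :: v) okv.
  by apply: hv => //; apply: ltnW.
move=> g1; have [w wg] := nfP g; exists (fun h => act h dl w).
have [_ gw _] := nf_act w g wg.
split; first by exists (size w).+1; apply: polact.
rewrite act1; case: w wg gw => [wg|x w _ gw]; first by rewrite wg eqxx in g1.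
by [].
Qed.

End Magnus.

(** * Intersections of coset kernels *)

Lemma span_subspace (k : fieldType) (V : lmodType k) (W : V -> Prop) n (v : 'I_n -> V) :
  subspace W -> subspace (fun u => exists c : 'I_n -> k, W (u - \sum_i c i *: v i)).
Proof.
move=> sW; split.
- exists (fun=> 0); rewrite big1 ?subr0; first exact: sub0.
  by move=> j _; rewrite scale0r.
- move=> u1 u2 [c1 W1] [c2 W2]; exists (fun j => c1 j + c2 j).
  have -> : \sum_j (c1 j + c2 j) *: v j = \sum_j c1 j *: v j + \sum_j c2 j *: v j.
    by rewrite -big_split; apply: eq_bigr => j _; rewrite scalerDl.
  by rewrite opprD addrACA; apply: subD.
- move=> c u [c1 W1]; exists (fun j => c * c1 j).
  have -> : \sum_j (c * c1 j) *: v j = c *: \sum_j c1 j *: v j.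
    by rewrite scaler_sumr; apply: eq_bigr => j _; rewrite scalerA.
  by rewrite -scalerBr; apply: subZ.
Qed.

Definition fam_cat T m n (f : 'I_m -> T) (g : 'I_n -> T) (j : 'I_(m + n)) : T :=
  match split j with inl l => f l | inr l => g l end.

Lemma fam_catl T m n (f : 'I_m -> T) (g : 'I_n -> T) l : fam_cat f g (lshift n l) = f l.
Proof. by rewrite /fam_cat (unsplitK (inl l)). Qed.

Lemma fam_catr T m n (f : 'I_m -> T) (g : 'I_n -> T) l : fam_cat f g (rshift m l) = g l.
Proof. by rewrite /fam_cat (unsplitK (inr l)). Qed.

Lemma sum_fam_cat (k : fieldType) (V : lmodType k) m n (f : 'I_m -> V) (g : 'I_n -> V)
    (c : 'I_(m + n) -> k) :
  \sum_j c j *: fam_cat f g j =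
  \sum_l c (lshift n l) *: f l + \sum_l c (rshift m l) *: g l.
Proof.
rewrite big_split_ord; congr (_ + _); apply: eq_bigr => l _.
  by rewrite fam_catl.
by rewrite fam_catr.
Qed.

Section Rank.
Variables (F : groupType) (X : choiceType) (i : X -> F).
Hypothesis free_i : free_on i.
Local Notation A := {malg rat[F]}.
Implicit Types (P Q S E : F -> Prop) (u v : A).

Definition cap (U1 U2 : A -> Prop) u := U1 u /\ U2 u.

Lemma gen_map_in (Y : choiceType) (b : Y -> A) (U : A -> Prop)
    (x : {malg rat[(F * Y)%type]}) :
  submodule U -> (forall p, x@_p != 0 -> U (b p.2)) -> U (gen_map b x).
Proof.
move=> sU Ub; have sU' := smS sU; rewrite /gen_map /lext big_seq.
apply: (sub_sum _ sU') => p; rewrite -mcoeff_neq0 => /Ub Up.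
by apply: (subZ sU'); apply: (smT sU).
Qed.

Lemma cap_submodule P Q : subgroup P -> subgroup Q -> submodule (cap (cker P) (cker Q)).
Proof.
move=> /(cker_submodule rat) mP /(cker_submodule rat) mQ.
have nP := smS mP; have nQ := smS mQ.
split; last by move=> g v [vP vQ]; exact: (conj (smT mP g vP) (smT mQ g vQ)).
split=> [|v1 v2 [] ? ? [] ? ?|c v1 []]; split.
- exact: (sub0 nP).
- exact: (sub0 nQ).
- exact: (subD nP).
- exact: (subD nQ).
- exact: (subZ nP).
- exact: (subZ nQ).
Qed.

(** The sequence 0 -> cker P /\ cker Q -> cker P + cker Q -> cker S -> 0, with
a direct sum in the middle, splits because cker S is projective.  It therefore
stays exact modulo I. *)
Lemma aug_cap P Q S u : subgroup P -> subgroup Q -> subgroup S ->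
  (forall g, P g -> S g) -> (forall g, Q g -> S g) ->
  (forall g, S g -> gen (fun h => P h \/ Q h) g) ->
  aug (cker P) u -> aug (cker Q) u -> aug (cap (cker P) (cker Q)) u.
Proof.
move=> sP sQ sS PS QS SG uP uQ.
have [Y [b [s [Jb bs sT]]]] := cker_projective rat free_i sS.
have /choice [b12 b12P] y : exists p : A * A, [/\ cker P p.1, cker Q p.2 & b y = p.1 + p.2].
  by have [b1 [b2 [? ? ?]]] := cker_join sP sQ sS SG (Jb y); exists (b1, b2).
(* Lifting the images b y of the generators gives a splitting (l1 s, l2 s) of
   the sum map.  Then v |-> v - l1 (s v) maps cker P to the intersection,
   v |-> l1 (s v) = v - l2 (s v) does so for cker Q, and the two maps add up to
   the identity. *)
pose l1 := gen_map (fun y => (b12 y).1); pose l2 := gen_map (fun y => (b12 y).2).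
have l12 x : gen_map b x = l1 x + l2 x.
  apply: (lin_ext (f := gen_map b) (g := l1 \+ l2)) => -[g y] /=.
  rewrite /l1 /l2 /gen_map !lextU /=; have [_ _ ->] := b12P y; exact: linearD.
have l1P x : cker P (l1 x).
  by apply: gen_map_in; [apply: cker_submodule|move=> p _; have [] := b12P p.2].
have l2Q x : cker Q (l2 x).
  by apply: gen_map_in; [apply: cker_submodule|move=> p _; have [] := b12P p.2].
have nP := cker_subspace rat sP; have nQ := cker_subspace rat sQ.
have JPS v : cker P v -> cker S v by apply: cker_mono.
have JQS v : cker Q v -> cker S v by apply: cker_mono.
pose f0 : {linear A -> A} := idfun \- (gen_map (fun y => (b12 y).1) \o s).
pose f1 : {linear A -> A} := gen_map (fun y => (b12 y).1) \o s.
have f0E v : f0 v = v - l1 (s v) by [].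
have f1E v : f1 v = l1 (s v) by [].
have a0 : aug (cap (cker P) (cker Q)) (f0 u).
  apply: aug_image uP => [v vP|h v vP].
    split; first by rewrite f0E; apply: (subB nP).
    have -> : f0 v = l2 (s v); last exact: l2Q.
    by rewrite f0E -{1}[v](bs _ (JPS _ vP)) l12 [l1 _ + _]addrC addrK; reflexivity.
  exists h; rewrite !f0E sT; last exact: JPS.
  by rewrite /l1 gen_map_gactY -linearB.
have a1 : aug (cap (cker P) (cker Q)) (f1 u).
  apply: aug_image uQ => [v vQ|h v vQ].
    split; first by rewrite f1E.
    have -> : f1 v = v - l2 (s v).
      by rewrite f1E -{2}[v](bs _ (JQS _ vQ)) l12 addrK; reflexivity.
    exact: (subB nQ).
  exists h; rewrite !f1E sT; last exact: JQS.
  by rewrite /l1 gen_map_gactY.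
have -> : u = f0 u + f1 u by rewrite f0E f1E subrK.
exact: (subD (aug_subspace (smS (cap_submodule sP sQ))) a0 a1).
Qed.

(** Elements of the intersection that are independent modulo I, placed
antidiagonally in the direct sum of cker P and cker Q, together with lifts of a
basis z of cker S modulo I, are independent modulo I in that direct sum, whose
dimension modulo I is at most r + a. *)
Lemma cap_dim_le P Q S r a d (v : 'I_r -> A) (w : 'I_a -> A) (z : 'I_d -> A) :
  subgroup P -> subgroup Q -> subgroup S ->
  (forall g, P g -> S g) -> (forall g, Q g -> S g) ->
  (forall g, S g -> gen (fun h => P h \/ Q h) g) ->
  spans (aug (cker P)) (cker P) v -> spans (aug (cker Q)) (cker Q) w ->
  (forall j, cker S (z j)) -> indep (aug (cker S)) z -> (a <= d)%N ->
  dim_le (aug (cap (cker P) (cker Q))) (cap (cker P) (cker Q)) r.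
Proof.
move=> sP sQ sS PS QS SG [vP vS] [wQ wS] Jz zind led m u uK uind.
have nP := cker_subspace rat sP; have nQ := cker_subspace rat sQ.
have aP := aug_subspace nP; have aQ := aug_subspace nQ.
have aS := aug_subspace (cker_subspace rat sS).
pose W (p : A * A) := aug (cker P) p.1 /\ aug (cker Q) p.2.
pose U (p : A * A) := cker P p.1 /\ cker Q p.2.
have fstS n (f : 'I_n -> A * A) : (\sum_j f j).1 = \sum_j (f j).1.
  by apply: (big_morph (fun p : A * A => p.1)).
have sndS n (f : 'I_n -> A * A) : (\sum_j f j).2 = \sum_j (f j).2.
  by apply: (big_morph (fun p : A * A => p.2)).
have sW : subspace W.
  split=> [|p q [] ? ? [] ? ?|c p []]; split.
  - exact: (sub0 aP).
  - exact: (sub0 aQ).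
  - exact: (subD aP).
  - exact: (subD aQ).
  - exact: (subZ aP).
  - exact: (subZ aQ).
pose vw := fam_cat (fun j => (v j, 0) : A * A) (fun j => (0, w j) : A * A).
have vwS : spans W U vw.
  split=> [j|[p q] [/vS [c cP] /wS [c' cQ]]].
    rewrite /vw /fam_cat; case: split => l.
      exact: (conj (vP l) (sub0 nQ)).
    exact: (conj (sub0 nP) (wQ l)).
  exists (fam_cat c c'); rewrite sum_fam_cat.
  under eq_bigr do rewrite fam_catl.
  under [X in _ - (_ + X)]eq_bigr do rewrite fam_catr.
  split; rewrite /= ?fstS ?sndS /=.
    rewrite [X in _ - (_ + X)]big1 => [|j _]; last exact: scaler0.
    by rewrite addr0; exact: cP.
  rewrite [X in _ - (X + _)]big1 => [|j _]; last exact: scaler0.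
  by rewrite add0r; exact: cQ.
have /choice [z12 z12P] j : exists p : A * A, [/\ cker P p.1, cker Q p.2 & z j = p.1 + p.2].
  by have [z1 [z2 [? ? ?]]] := cker_join sP sQ sS SG (Jz j); exists (z1, z2).
pose uz := fam_cat (fun j => (u j, - u j) : A * A) z12.
suff lemr : (m + d <= r + a)%N by rewrite -(leq_add2r d) (leq_trans lemr) // leq_add2l.
apply: (spans_dim_le sW vwS (v := uz)) => [j|c].
  rewrite /uz /fam_cat; case: split => l; last by have [] := z12P l.
  by have [uP uQ] := uK l; exact: (conj uP (subN nQ uQ)).
rewrite sum_fam_cat; case; rewrite /= !fstS !sndS /=.
set u1 := \sum_j c (lshift d j) *: u j.
have -> : \sum_j c (lshift d j) *: - u j = - u1.
  by rewrite -sumrN; apply: eq_bigr => j _; rewrite scalerN.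
move=> p1 p2.
have cz j : c (rshift m j) = 0.
  apply: (zind (fun j => c (rshift m j))).
  have := subD aS (aug_mono (fun v => cker_mono (u := v) sP sS PS) p1)
    (aug_mono (fun v => cker_mono (u := v) sQ sS QS) p2).
  rewrite addrACA subrr add0r -big_split /=; congr (aug _ _).
  by apply: eq_bigr => l _; rewrite -scalerDr; have [_ _ ->] := z12P l.
rewrite big1 ?addr0 in p1; last by move=> j _; rewrite cz scale0r.
rewrite big1 ?addr0 in p2; last by move=> j _; rewrite cz scale0r.
have u1K : aug (cap (cker P) (cker Q)) u1.
  apply: (aug_cap sP sQ sS PS QS SG p1).
  by have := subN aQ p2; rewrite opprK.
move=> j; rewrite -[j]splitK; case: split => l //=.
exact: (uind (fun j => c (lshift d j))).
Qed.

(** Modulo I one has g(e - 1) = e - 1 and ee' - 1 = (e - 1) + (e' - 1). *)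
Lemma cker_fg_spans (s : seq F) (E := gen (fun g => g \in s)) :
  spans (aug (cker E)) (cker E) (fun j : 'I_(size s) => << tnth (in_tuple s) j >> - << 1%g >> : A).
Proof.
have sE : subgroup E by apply: gen_subgroup.
have nE := cker_subspace rat sE; have aE := aug_subspace nE.
set v := fun j : 'I_(size s) => _.
have vE (e : F) : E e -> cker E (<< e >> - << 1%g >> : A).
  by move=> Ee; rewrite -[e]mul1g; apply: cker_gen.
split=> [j|]; first by apply/vE/gen_in/mem_tnth.
have sp := span_subspace v aE.
have red g e : E e -> aug (cker E) (<< (g * e)%g >> - << g >> - (<< e >> - << 1%g >>) : A).
  move=> Ee; have := aug_gen g (vE e Ee); rewrite linearB /= !gactU mulg1; exact.
apply: (cker_ind sE sp) => g e Ee.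
suff [c cP] : exists c : 'I_(size s) -> rat,
    aug (cker E) (<< e >> - << 1%g >> - \sum_j c j *: v j).
  by exists c; have := subD aE (red g e Ee) cP; rewrite addrA subrK.
elim: Ee {g} => {e} [e es|//|e e' Ee IH Ee' IH'|e Ee IH].
- have [j ->] : exists j : 'I_(size s), e = tnth (in_tuple s) j.
    by apply/tnthP; rewrite memtE.
  exists (fun l => (l == j)%:R); rewrite (bigD1 j) //= eqxx scale1r big1 ?addr0.
    by rewrite /v subrr; apply: (sub0 aE).
  by move=> l /negPf ->; rewrite scale0r.
- by rewrite subrr; apply: (sub0 sp).
- have [c cP] := subD sp IH IH'; exists c.
  have := subD aE (red e e' Ee') cP; congr (aug _ _).
  rewrite addrA; congr (_ - _).
  by rewrite [X in _ + X = _]addrC addrA subrK addrA subrK; reflexivity.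
- have [c cP] := subN sp IH; exists c.
  have := red e e^-1%g (genV Ee); rewrite mulgV => r1.
  have := subB aE cP r1; rewrite opprB; congr (aug _ _).
  by rewrite [in LHS]opprB addrC addrA subrK; reflexivity.
Qed.

End Rank.

(** * Iterates of an endomorphism *)

Section Stabilize.
Variables (F : groupType) (X : choiceType) (i : X -> F).
Hypothesis free_i : free_on i.
Variables (Psi : F -> F) (s0 : seq F).
Hypothesis PsiM : forall g h, Psi (g * h)%g = (Psi g * Psi h)%g.
Local Notation A := {malg rat[F]}.

Lemma Psi1 : Psi 1%g = 1%g.
Proof. by apply: (@mulgI _ (Psi 1%g)); rewrite -PsiM !mulg1. Qed.

Lemma PsiV g : Psi g^-1%g = (Psi g)^-1%g.
Proof. by apply: (@mulgI _ (Psi g)); rewrite -PsiM !mulgV Psi1. Qed.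

Definition levels a b : seq F := [seq iter l Psi x | l <- index_iota a b, x <- s0].
Definition window a b : F -> Prop := gen (fun g => g \in levels a b).
Definition tail a : F -> Prop := fun g => exists b, window a b g.

Lemma levelsP a b g :
  reflect (exists l x, [/\ (a <= l < b)%N, x \in s0 & g = iter l Psi x]) (g \in levels a b).
Proof.
apply: (iffP allpairsP) => [[[l x] /= [la xs ->]]|[l [x [la xs ->]]]].
  by exists l, x; split=> //; rewrite mem_index_iota in la.
by exists (l, x); rewrite /= mem_index_iota.
Qed.

Lemma window_subgroup a b : subgroup (window a b).
Proof. exact: gen_subgroup. Qed.

Lemma window_mono a b a' b' g : (a' <= a)%N -> (b <= b')%N -> window a b g -> window a' b' g.
Proof.
move=> aa bb; apply: gen_mono => h /levelsP [l [x [/andP [al lb] xs ->]]].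
apply/gen_in/levelsP; exists l, x; split=> //.
by rewrite (leq_trans aa al) (leq_trans lb bb).
Qed.

Lemma tail_subgroup a : subgroup (tail a).
Proof.
split=> [|g h [b Eg] [b' Eh]|g [b Eg]].
- by exists 0%N; apply: gen1.
- exists (maxn b b'); apply: genM.
    by apply: window_mono Eg; rewrite ?leq_maxl.
  by apply: window_mono Eh; rewrite ?leq_maxr.
- by exists b; apply: genV.
Qed.

Lemma window_Psi a b g : window a b g -> window a.+1 b.+1 (Psi g).
Proof.
elim=> {g} [g /levelsP [l [x [ab xs ->]]]||g h _ Eg _ Eh|g _ Eg].
- by apply/gen_in/levelsP; exists l.+1, x.
- by rewrite Psi1; apply: gen1.
- by rewrite PsiM; apply: genM.
- by rewrite PsiV; apply: genV.
Qed.

Lemma window_Psi_inv a b g : window a.+1 b.+1 g -> exists g', window a b g' /\ g = Psi g'.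
Proof.
elim=> {g} [g /levelsP [[|l] [x [ab xs ->]]]||g h _ [g' [Eg ->]] _ [h' [Eh ->]]|g _ [g' [Eg ->]]].
- by [].
- by exists (iter l Psi x); split=> //; apply/gen_in/levelsP; exists l, x.
- by exists 1%g; rewrite Psi1; split=> //; apply: gen1.
- by exists (g' * h')%g; rewrite PsiM; split=> //; apply: genM.
- by exists (g'^-1)%g; rewrite PsiV; split=> //; apply: genV.
Qed.

Lemma window_split a b c d g : (a <= c <= b)%N -> (d <= b)%N -> (c <= d)%N -> window a b g ->
  gen (fun h => window a d h \/ window c b h) g.
Proof.
move=> /andP [ac cb] db cd; apply: gen_min; first exact: gen_subgroup.
move=> h /levelsP [l [x [/andP [al lb] xs ->]]]; apply: gen_in.
have [ld|dl] := ltnP l d; [left|right]; apply/gen_in/levelsP; exists l, x.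
  by rewrite al ld.
by rewrite (leq_trans cd dl) lb.
Qed.

Lemma cker_tail a (u : A) : cker (tail a) u -> exists b, cker (window a b) u.
Proof.
have sI := tail_subgroup a.
apply: (cker_ind (P := fun u : A => exists b, cker (window a b) u) sI).
  split=> [|u1 u2 [b1 J1] [b2 J2]|c u1 [b J1]].
  - by exists 0%N; exact: (sub0 (cker_subspace _ (window_subgroup a 0))).
  - exists (maxn b1 b2); apply: (subD (cker_subspace _ (window_subgroup a (maxn b1 b2)))).
      apply: (cker_mono (window_subgroup a b1) (window_subgroup a _) _ J1) => g.
      by apply: window_mono; rewrite ?leq_maxl.
    apply: (cker_mono (window_subgroup a b2) (window_subgroup a _) _ J2) => g.
    by apply: window_mono; rewrite ?leq_maxr.
  - by exists b; apply: (subZ (cker_subspace _ (window_subgroup a b))).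
by move=> g e [b Ee]; exists b; exact: (cker_gen _ _ (window_subgroup a b) Ee).
Qed.

Lemma cker_window_mono a b a' b' (u : A) : (a' <= a)%N -> (b <= b')%N ->
  cker (window a b) u -> cker (window a' b') u.
Proof.
move=> aa bb; apply: (cker_mono (window_subgroup a b) (window_subgroup a' b')) => g.
exact: window_mono.
Qed.

Lemma cker_window_tail a b (u : A) : cker (window a b) u -> cker (tail a) u.
Proof.
by apply: (cker_mono (window_subgroup a b) (tail_subgroup a)) => g Eg; exists b.
Qed.

(** Since Psi maps window 0 n onto window 1 n.+1, it carries a spanning family
of the first quotient modulo I to a spanning family of the second. *)
Lemma spans_Psi n d (v : 'I_d -> A) :
  spans (aug (cker (window 0 n))) (cker (window 0 n)) v ->
  spans (aug (cker (window 1 n.+1))) (cker (window 1 n.+1)) (fun j => push Psi (v j)).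
Proof.
move=> [vJ vS].
have s1 := window_subgroup 1 n.+1; have s0' := window_subgroup 0 n.
have a1 := aug_subspace (cker_subspace rat s1).
have pJ (u : A) : cker (window 0 n) u -> cker (window 1 n.+1) (push Psi u).
  by apply: (cker_push s0' s1 PsiM) => g; apply: window_Psi.
split=> [j|]; first exact: pJ.
apply: (cker_ind s1 (span_subspace _ a1)) => g e /window_Psi_inv [e' [Ee ->]].
have Je : cker (window 0 n) (<< e' >> - << 1%g >> : A).
  by rewrite -[X in << X >> - _]mul1g; exact: (cker_gen _ _ s0' Ee).
have [c cP] := vS _ Je; exists c.
have r1 := aug_gen g (pJ _ Je).
have pT h (u : A) : push Psi (gact h u) = gact (Psi h) (push Psi u).
  rewrite /gact !push_push; apply: eq_lext => l /=; by rewrite PsiM.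
have r2 : aug (cker (window 1 n.+1)) (push Psi (<< e' >> - << 1%g >> - \sum_j c j *: v j)).
  apply: aug_image cP; first exact: pJ.
  by move=> h u _; exists (Psi h); exact: pT.
have := subD a1 r1 r2; congr (aug _ _).
have pB (u1 u2 : A) : push Psi (u1 - u2) = push Psi u1 - push Psi u2 := linearB _ _ _.
rewrite [in X in _ + X]pB addrA subrK pB !pushU Psi1 linearB /= !gactU mulg1.
congr (_ - _); rewrite linear_sum; apply: eq_bigr => j _; exact: linearZ_LR.
Qed.

(** The coordinate along y, applied to U, has image B with B = I B. *)
Lemma coord_zero (Y : choiceType) (s : {linear A -> {malg rat[(F * Y)%type]}})
    (U : A -> Prop) d (v : 'I_d -> A) (y : Y) :
  (forall g u, U u -> s (gact g u) = gactY g (s u)) ->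
  spans (aug U) U v ->
  (forall j p, (s (v j))@_p != 0 -> p.2 != y) ->
  forall u p, U u -> (s u)@_p != 0 -> p.2 != y.
Proof.
move=> sT [vU vS] sv u p Uu; apply: contra_neq => py.
pose pr : {linear {malg rat[(F * Y)%type]} -> A} :=
  lext (fun q : F * Y => if q.2 == y then << q.1 >> else 0 : A).
have prE x q : (pr x)@_q = x@_(q, y).
  elim/malg_lin_ind: x => [|c [h z] x IH]; first by rewrite linear0 !mcoeff0.
  rewrite linearP /= !mcoeffD !mcoeffZ IH; congr (_ * _ + _).
  rewrite /pr lextU /= mcoeffU xpair_eqE.
  by case: (z == y); rewrite ?andbT ?andbF ?mcoeffU ?mcoeff0.
have prT g x : pr (gactY g x) = gact g (pr x).
  apply: (lin_ext (f := pr \o @gactY _ _ _ g) (g := gact g \o pr)) => -[h z] /=.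
  rewrite /gactY pushU /pr !lextU /=; case: (z == y); first by rewrite gactU.
  by rewrite linear0.
pose B b := exists u, U u /\ b = pr (s u).
suff B0 : pr (s u) = 0.
  by case: p py => h z /= ->; rewrite -prE B0 mcoeff0.
apply: (aug_eq0 (magnus_separates free_i) (B := B)); last by exists u.
move=> _ [u1 [U1 ->]]; have [c cP] := vS _ U1.
have : aug B (pr (s (u1 - \sum_j c j *: v j))).
  apply: (aug_image (f := pr \o s)) cP => [u2 U2|h u2 U2]; first by exists u2.
  by exists h; rewrite /= sT // prT.
pose ps : {linear A -> A} := pr \o s.
have psB (u2 u3 : A) : ps (u2 - u3) = ps u2 - ps u3 := linearB _ _ _.
have psS : ps (\sum_j c j *: v j) = 0.
  rewrite linear_sum big1 // => j _; rewrite linearZ_LR.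
  apply/malgP => q; rewrite mcoeffZ mcoeff0 [ps _]/(pr (s (v j))) prE.
  have [->|/sv] := eqVneq (s (v j))@_(q, y) 0; first by rewrite mulr0.
  by rewrite eqxx.
rewrite -[pr (s (_ - _))]/(ps (u1 - \sum_j c j *: v j)) psB psS subr0; exact.
Qed.

(** The intersections K n with finite windows have at most r dimensions modulo I
for infinitely many n, hence so does their union Ki.  The coordinates of Ki with
respect to generators b y of cker (tail 1) vanish outside a finite set ys, and
each b y belongs to cker of a finite window. *)
Theorem cker_stable : exists m, forall u : A,
  cker (window 0 1) u -> cker (tail 1) u -> cker (window 1 m) u.
Proof.
have sE := window_subgroup; have sI := tail_subgroup 1.
have nE a b := cker_subspace rat (sE a b).
have /choice [d dP] n : exists d, exists b : 'I_d -> A,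
    spans (aug (cker (window 0 n))) (cker (window 0 n)) b /\ indep (aug (cker (window 0 n))) b.
  have aE := aug_subspace (nE 0%N n).
  exact: (dim_le_basis aE (spans_dim_le aE (cker_fg_spans (levels 0 n)))).
set r := size (levels 0 1).
pose K n := cap (cker (window 0 1)) (cker (window 1 n.+1) : A -> Prop).
pose Ki := cap (cker (window 0 1)) (cker (tail 1) : A -> Prop).
have Kdim n : (d n <= d n.+1)%N -> dim_le (aug (K n)) (K n) r.
  have [b [/spans_Psi bS _]] := dP n; have [z [[zJ _] zI]] := dP n.+1 => led.
  apply: (cap_dim_le free_i (sE 0 1)%N (sE 1 n.+1)%N (sE 0 n.+1)%N _ _ _
    (cker_fg_spans (levels 0 1)) bS zJ zI led).
  - by move=> g; apply: window_mono.
  - by move=> g; apply: window_mono.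
  - by move=> g; apply: window_split.
(* a sequence of natural numbers does not decrease forever *)
have inc N : exists2 n, (N <= n)%N & (d n <= d n.+1)%N.
  apply: contrapT => noinc.
  have dec j : (d (N + j) + j <= d N)%N.
    elim: j => [|j IH]; first by rewrite !addn0.
    have : (d (N + j).+1 < d (N + j))%N.
      rewrite ltnNge; apply/negP => led; apply: noinc.
      by exists (N + j)%N => //; rewrite leq_addr.
    by rewrite !addnS; lia.
  by have := dec (d N).+1; lia.
have K_Ki n u : K n u -> Ki u.
  by case=> u0 u1; split=> //; apply: cker_window_tail u1.
have Kidim : dim_le (aug Ki) Ki r.
  move=> m v vK vind.
  have /choice [f fP] j : exists n, K n (v j).
    have [v0 /cker_tail [b vb]] := vK j; exists b; split=> //.
    exact: cker_window_mono vb.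
  have [n le_n led] := inc (\max_j f j).
  apply: (Kdim n led m v) => [j|c vc].
    have [v0 v1] := fP j; split=> //; apply: cker_window_mono v1 => //.
    by rewrite ltnS (leq_trans _ le_n) // leq_bigmax.
  by apply: vind; apply: aug_mono vc; apply: K_Ki.
have sKi : submodule Ki := cap_submodule (sE 0 1)%N sI.
have [q [v [vS _]]] := dim_le_basis (aug_subspace (smS sKi)) Kidim.
have [Y [b [s [Jb bs sT]]]] := cker_projective rat free_i sI.
have /choice [f fP] y := cker_tail (Jb y).
(* the finitely many coordinates seen by a basis of Ki modulo I *)
pose ys := flatten [seq [seq p.2 | p <- msupp (s (v j))] | j <- enum 'I_q].
exists (\max_(y <- ys) f y) => u u0 u1.
rewrite -(bs u u1); apply: gen_map_in; first exact: cker_submodule.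
move=> p up; apply: cker_window_mono (fP p.2) => //.
suff pys : p.2 \in ys by rewrite leq_bigmax_seq.
apply: contrapT => npys.
suff : p.2 != p.2 by rewrite eqxx.
apply: (coord_zero (U := Ki) _ vS _ (conj u0 u1) up).
  by move=> g u2 [_ u2I]; apply: sT.
move=> j p' p'0; apply/eqP => p'p; apply: npys; rewrite -p'p.
apply/flatten_mapP; exists j; first by rewrite mem_enum.
by apply: map_f; rewrite -mcoeff_neq0.
Qed.

(** Once the intersection with cker (window 0 1) is stationary, so is the one
with every longer window: subtract the part that lies in window 1 n. *)
Corollary cker_window : exists m, (0 < m)%N /\ forall n (u : A), (m <= n)%N ->
  cker (window 0 n) u -> cker (window 1 n.+1) u -> cker (window 1 n) u.
Proof.
have [m mP] := cker_stable; exists m.+1; split=> // n u lemn u0 u1.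
have sE := window_subgroup; have nE a b := cker_subspace rat (sE a b).
have [v0 [v1 [J0 J1 uE]]] : exists v0 v1, [/\ cker (window 0 1) v0, cker (window 1 n) v1 & u = v0 + v1].
  apply: (cker_join (sE 0 1)%N (sE 1 n)%N (sE 0 n)%N _ u0) => g.
  by apply: window_split; rewrite ?(leq_trans _ lemn).
rewrite uE; apply: (subD (nE 1%N n)) => //.
have : cker (window 1 m) v0.
  apply: mP => //; apply: (@cker_window_tail _ n.+1).
  rewrite -[v0](addrK v1) -uE; apply: (subB (nE 1%N n.+1)) => //.
  exact: cker_window_mono J1.
by apply: cker_window_mono => //; apply: ltnW.
Qed.

End Stabilize.

(** * A criterion for amalgams *)

Section AltSum.
Variable T : choiceType.

Fixpoint altsum (s : seq T) : {malg rat[T]} :=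
  if s is t :: s' then << t >> - altsum s' else 0.

Lemma altsum_coef t s : t \notin s -> (altsum s)@_t = 0.
Proof.
elim: s => [|x s IH]; first by rewrite mcoeff0.
rewrite inE negb_or /= => /andP [tx /IH ts].
by rewrite mcoeffB ts mcoeffU eq_sym (negPf tx) subr0.
Qed.

End AltSum.

Lemma push_altsum (T T' : choiceType) (f : T -> T') s :
  push f (altsum s) = altsum (map f s) :> {malg rat[T']}.
Proof.
elim: s => [|t s IH]; first exact: linear0.
by rewrite /= linearB /= pushU IH; reflexivity.
Qed.

Section Amalgam.
Variables (F G : groupType) (P R Q : F -> Prop).
Hypotheses (sP : subgroup P) (sR : subgroup R) (sQ : subgroup Q).
Hypotheses (QP : forall g, Q g -> P g) (QR : forall g, Q g -> R g).
Hypothesis JQ : forall u : {malg rat[F]}, cker P u -> cker R u -> cker Q u.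
Variables (f1 f2 : F -> G).
Hypothesis f1M : forall g h, P g -> P h -> f1 (g * h)%g = (f1 g * f1 h)%g.
Hypothesis f2M : forall g h, R g -> R h -> f2 (g * h)%g = (f2 g * f2 h)%g.
Hypothesis f12 : forall g, Q g -> f1 g = f2 g.
Implicit Types (b : bool) (g h : F) (w : seq (bool * F)).

Let Eb b := if b then R else P.
Let fb b := if b then f2 else f1.

Let sE b : subgroup (Eb b). Proof. by case: b. Qed.
Let QE b g : Q g -> Eb b g. Proof. by case: b => [/QR|/QP]. Qed.
Let fbM b g h : Eb b g -> Eb b h -> fb b (g * h)%g = (fb b g * fb b h)%g.
Proof. by case: b; [apply: f2M|apply: f1M]. Qed.
Let fb1 b : fb b 1%g = 1%g.
Proof. by apply: (@mulgI _ (fb b 1%g)); rewrite -fbM ?mulg1 //; apply: sg1. Qed.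
Let fbV b g : Eb b g -> fb b g^-1%g = (fb b g)^-1%g.
Proof.
by move=> Eg; apply: (@mulgI _ (fb b g)); rewrite -fbM ?mulgV //; apply: sgV.
Qed.
Let fbQ b g : Q g -> fb b g = f1 g. Proof. by case: b => // /f12. Qed.

(** Words in the letters of P and of R: the boolean tells which of the two
subgroups a letter comes from. *)
Fixpoint letters_in w : Prop := if w is (b, g) :: w' then Eb b g /\ letters_in w' else True.
Fixpoint lprod w : F := if w is (b, g) :: w' then (g * lprod w')%g else 1%g.
Fixpoint limage w : G := if w is (b, g) :: w' then (fb b g * limage w')%g else 1%g.
Fixpoint alternates b w : bool :=
  if w is (c, _) :: w' then (c == b) && alternates (~~ b) w' else true.
Fixpoint prefixes g w : seq F := if w is (_, h) :: w' then g :: prefixes (g * h)%g w' else [::].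

Let ok_cat w1 w2 : letters_in (w1 ++ w2) <-> letters_in w1 /\ letters_in w2.
Proof.
elim: w1 => [|[b g] w1 IH] /=; first by split=> [|[]].
by rewrite IH; split=> [[? []]|[[]]].
Qed.
Let val_cat w1 w2 : lprod (w1 ++ w2) = (lprod w1 * lprod w2)%g.
Proof. by elim: w1 => [|[b g] w1 IH] /=; rewrite ?mul1g // IH mulgA. Qed.
Let img_cat w1 w2 : limage (w1 ++ w2) = (limage w1 * limage w2)%g.
Proof. by elim: w1 => [|[b g] w1 IH] /=; rewrite ?mul1g // IH mulgA. Qed.

Let altsum_even b w n g : size w = n.*2 -> letters_in w -> alternates b w ->
  altsum (map (rep (Eb b)) (prefixes g w)) = 0.
Proof.
elim: n w g => [|n IH] w g; first by move/size0nil->.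
rewrite doubleS; case: w => [|[c h] [|[c' h'] w]] //= [sw] [Eh [Eh' okw]].
move=> /andP [/eqP cb /andP [/eqP _]]; rewrite negbK => aw.
rewrite IH // subr0 rep_mulr ?subrr //; by rewrite -cb.
Qed.

Let altsum_odd b w n g : size w = n.*2.+1 -> letters_in w -> alternates b w ->
  altsum (map (rep (Eb b)) (prefixes g w)) = << rep (Eb b) (g * lprod w)%g >>.
Proof.
elim: n w g => [|n IH] w g; rewrite ?doubleS.
  case: w => [|[c h] [|//]] //= _ [Eh _].
  by move=> /andP [/eqP cb _]; rewrite subr0 mulg1 rep_mulr // -cb.
case: w => [|[c h] [|[c' h'] w]] //= [sw] [Eh [Eh' okw]] /andP [/eqP cb /andP [/eqP _]]; rewrite negbK => aw.
rewrite IH // rep_mulr; [|by []|by rewrite -cb].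
by rewrite opprB addrC subrK !mulgA; reflexivity.
Qed.

Let mem_pre g w x : x \in prefixes g w ->
  exists w1 w2, [/\ w = w1 ++ w2, w2 != [::] & x = (g * lprod w1)%g].
Proof.
elim: w g => [|[b h] w IH] g //=; rewrite inE => /predU1P [->|/IH].
  by exists [::], ((b, h) :: w); rewrite mulg1.
by case=> w1 [w2 [-> w20 ->]]; exists ((b, h) :: w1), w2; rewrite /= mulgA.
Qed.

Let not_alt b w : ~~ alternates b w -> (if w is (c, _) :: _ then c = b else True) ->
  exists w1 c g h w2, w = w1 ++ (c, g) :: (c, h) :: w2.
Proof.
elim: w b => [|[c g] w IH] b //= + cb; rewrite cb eqxx /=.
case: w IH => [|[c' h] w] IH // nalt.
have [c'b|c'b] := eqVneq c' b; first by exists [::], b, g, h, w; rewrite c'b.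
have [|w1 [d [g1 [g2 [w2 ->]]]]] := IH _ nalt; first by case: c' b c'b {nalt cb IH} => [] [].
by exists ((b, g) :: w1), d, g1, g2, w2.
Qed.

Let alt_last b w c h : alternates b (rcons w (c, h)) -> c = b (+) odd (size w).
Proof.
elim: w b => [|[d g] w IH] b /=; first by rewrite andbT addbF => /eqP.
by case/andP=> _ /IH ->; case: b; case: (odd _).
Qed.

(** By induction on the length, reduce to a word that alternates cyclically
between P and R.  Consecutive partial products lie in the same coset of P, or of
R, alternately, so their alternating sum belongs to cker P and to cker R, hence
to cker Q.  Then some nonempty proper prefix of the word has its product q in Q,
and the word splits into two shorter ones, each absorbing q or its inverse. *)
Lemma amalgam_img w : letters_in w -> lprod w = 1%g -> limage w = 1%g.
Proof.
have [n] := ubnP (size w); elim: n w => // n IH [|[b g] w] //= ltn [Eg okw] w1.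
have [aw|] := boolP (alternates (~~ b) w); last first.
  move=> naw; have /not_alt : ~~ alternates b ((b, g) :: w) by rewrite /= eqxx.
  case=> // v1 [c [x [y [v2 E]]]].
  have okE : letters_in ((b, g) :: w) by []; have vE : lprod ((b, g) :: w) = 1%g by [].
  have sE' : size ((b, g) :: w) = (size (v1 ++ (c, (x * y)%g) :: v2)).+1.
    by rewrite E !size_cat /= !addnS.
  rewrite -[(_ * _)%g]/(limage ((b, g) :: w)).
  rewrite E ok_cat /= in okE; case: okE => ok1 [Ex [Ey ok2]].
  have -> : limage ((b, g) :: w) = limage (v1 ++ (c, (x * y)%g) :: v2).
    by rewrite E !img_cat /= (fbM Ex Ey) -!mulgA.
  apply: IH; last by rewrite -vE E !val_cat /= -!mulgA.
    by rewrite -ltnS -sE'.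
  by apply/ok_cat; split=> //=; split=> //; apply: (sgM (sE c)).
have [ow|ew] := boolP (odd (size w)); last first.
  case/lastP: w => [|w [c h]] in w1 okw aw ltn ew *.
    by move: w1; rewrite /= !mulg1 => ->; apply: fb1.
  rewrite size_rcons /= negbK in ew; have := alt_last aw; rewrite ew addbT negbK => cb.
  rewrite {c}cb -cats1 in w1 okw aw ltn *.
  move/ok_cat: okw => [okw [Eh _]].
  rewrite val_cat /= mulg1 in w1.
  have : limage (w ++ [:: (b, (h * g)%g)]) = 1%g.
    apply: IH; first by move: ltn; rewrite !size_cat /= addn1.
      by apply/ok_cat; split=> //=; split=> //; apply: (sgM (sE b)).
    rewrite val_cat /= mulg1; apply: (@mulgI _ g); rewrite mulg1.
    by rewrite -[RHS]mul1g -[in RHS]w1 !mulgA.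
  rewrite !img_cat /= !mulg1 fbM // => e1.
  apply: (@mulIg _ (fb b g)); rewrite mul1g -[RHS]mulg1 -e1 !mulgA //.
have [m sw] : exists m, size w = m.*2.+1.
  by exists (size w)./2; rewrite -[LHS]odd_double_half ow add1n.
have Jb : cker (Eb b) (altsum (prefixes 1%g ((b, g) :: w))).
  apply: in_cker; rewrite push_altsum (@altsum_even b _ m.+1) //=; first by rewrite sw.
  by rewrite eqxx aw.
have Jnb : cker (Eb (~~ b)) (altsum (prefixes 1%g ((b, g) :: w))).
  apply: in_cker; rewrite push_altsum /= (@altsum_odd (~~ b) w m) // mul1g w1.
  exact: subrr.
have [] : cker Q (altsum (prefixes 1%g ((b, g) :: w))).
  by case: b Jb Jnb {ltn Eg aw} => /= J1 J2; apply: JQ.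
rewrite push_altsum /= mul1g => /(congr1 (mcoeff (rep Q 1%g))).
rewrite mcoeffB mcoeffU eqxx mcoeff0.
have [/mapP [x /mem_pre [v1 [v2 [E v20 ->]]] xQ]|/altsum_coef ->] :=
  boolP (rep Q 1%g \in map (rep Q) (prefixes g w)); last first.
  by rewrite subr0 => /eqP; rewrite oner_eq0.
move=> _; have /(rep_eq _ _ sQ) := xQ; rewrite invg1 mul1g => {xQ}.
set q := (g * lprod v1)%g => qQ.
rewrite E in okw w1 ltn *; case/ok_cat: okw => ok1 ok2.
case: v2 v20 E ok2 w1 ltn => // -[c h] v2 _ E /= [Eh ok2] w1.
rewrite size_cat /= => ltn.
have i1 : limage ((b, (q^-1 * g)%g) :: v1) = 1%g.
  apply: IH => /=; first by lia.
    by split=> //; apply: (sgM (sE b)) => //; apply/QE/(sgV sQ).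
  by rewrite -mulgA mulVg.
have i2 : limage ((c, (q * h)%g) :: v2) = 1%g.
  apply: IH => /=; first by lia.
    by split=> //; apply: (sgM (sE c)) => //; apply: QE.
  by move: w1; rewrite val_cat /= /q !mulgA.
rewrite img_cat /= mulgA.
rewrite /= fbM // in i1; last exact/QE/(sgV sQ).
rewrite fbV // in i1; last exact: QE.
rewrite /= fbM // in i2; last exact: QE.
have -> : (fb b g * limage v1)%g = fb b q.
  by apply: (@mulgI _ (fb b q)^-1%g); rewrite mulVg mulgA.
by rewrite fbQ // -(fbQ c qQ) mulgA.
Qed.

Lemma amalgam_ext : exists psi : F -> G, [/\ forall g, P g -> psi g = f1 g,
  forall g, R g -> psi g = f2 g &
  forall g h, gen (fun l => P l \/ R l) g -> gen (fun l => P l \/ R l) h ->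
    psi (g * h)%g = (psi g * psi h)%g].
Proof.
pose inw w : seq (bool * F) := rev [seq (p.1, (p.2)^-1%g) | p <- w].
have inwP w : letters_in w -> [/\ letters_in (inw w), lprod (inw w) = (lprod w)^-1%g &
    limage (inw w) = (limage w)^-1%g].
  elim: w => [|[b g] w IH] /=; first by rewrite !invg1.
  case=> Eg /IH [o v m]; rewrite /inw /= rev_cons -cats1 -/(inw w).
  rewrite val_cat img_cat /= !mulg1 v m fbV // !invgM; split=> //.
  by apply/ok_cat; split=> //=; split=> //; apply: (sgV (sE b)).
have uniq_img w w' : letters_in w -> letters_in w' -> lprod w = lprod w' -> limage w = limage w'.
  move=> okw /inwP [o v m] vv; apply: divg1_eq; rewrite -m -img_cat.
  by apply: amalgam_img; [apply/ok_cat|rewrite val_cat v vv mulgV].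
have words g : gen (fun l => P l \/ R l) g -> exists w, letters_in w /\ lprod w = g.
  elim=> {g} [g [Pg|Rg]||g h _ [w [ow <-]] _ [v [ov <-]]|g _ [w [ow <-]]].
  - by exists [:: (false, g)]; rewrite /= mulg1.
  - by exists [:: (true, g)]; rewrite /= mulg1.
  - by exists [::].
  - by exists (w ++ v); rewrite val_cat; split=> //; apply/ok_cat.
  - by have [? ? _] := inwP _ ow; exists (inw w).
have /choice [ch chP] g : exists w, gen (fun l => P l \/ R l) g -> letters_in w /\ lprod w = g.
  have [/words [w ?]|ng] := pselect (gen (fun l => P l \/ R l) g); first by exists w.
  by exists [::].
exists (fun g => limage (ch g)); split=> [g Pg|g Rg|g h Gg Gh].
- have [o v] : letters_in (ch g) /\ lprod (ch g) = g by apply/chP/gen_in; left.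
  by rewrite (uniq_img _ [:: (false, g)]) //= ?mulg1.
- have [o v] : letters_in (ch g) /\ lprod (ch g) = g by apply/chP/gen_in; right.
  by rewrite (uniq_img _ [:: (true, g)]) //= ?mulg1.
- have [og vg] := chP g Gg; have [oh vh] := chP h Gh.
  have [o v] := chP _ (genM Gg Gh).
  rewrite -img_cat; apply: uniq_img => //; first exact/ok_cat.
  by rewrite val_cat v vg vh.
Qed.

End Amalgam.

Local Close Scope ring_scope.

(** * Finite presentations *)

Section EvalPresented.
Variables (X : choiceType) (R : set (word X)) (G : groupType) (f : X -> G).
Hypothesis fR : forall r, R r -> eval f r = 1.

Definition eval_quot (a : presented R) : G := eval f (repr a).

Lemma eval_quot_class w : eval_quot (pres_class R w) = eval f w.
Proof. exact: eval_pres_eq fR (pres_repr R w). Qed.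

Lemma eval_quotM (a b : presented R) : eval_quot (a * b) = eval_quot a * eval_quot b.
Proof. by rewrite [a * b]/(pres_mul a b) /pres_mul eval_quot_class eval_cat. Qed.

Lemma eval_quot1 : eval_quot 1 = 1.
Proof. by rewrite [1 in LHS]/(pres_one R) /pres_one eval_quot_class. Qed.

Lemma eval_quotV (a : presented R) : eval_quot a^-1 = (eval_quot a)^-1.
Proof. by apply: (@mulgI _ (eval_quot a)); rewrite -eval_quotM !mulgV eval_quot1. Qed.

End EvalPresented.

Definition relabel (X Y : choiceType) (h : X -> Y) (w : word X) : word Y :=
  [seq (h a.1, a.2) | a <- w].

Lemma eval_relabel (X Y : choiceType) (h : X -> Y) (G : groupType) (f : Y -> G) w :
  eval f (relabel h w) = eval (fun x => f (h x)) w.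
Proof. by elim: w => [|[x b] w IH] //=; rewrite IH. Qed.

Lemma relabelK (X Y : choiceType) (h : X -> Y) (h' : Y -> X) :
  cancel h h' -> cancel (relabel h) (relabel h').
Proof.
by move=> hK w; rewrite /relabel -map_comp map_id_in // => -[x b] _ /=; rewrite hK.
Qed.

Lemma pres_eq_relabel (X Y : choiceType) (h : X -> Y) (R : set (word X))
    (R' : set (word Y)) u v : (forall r, R r -> R' (relabel h r)) ->
  pres_eq R u v -> pres_eq R' (relabel h u) (relabel h v).
Proof.
move=> RR'; elim=> {u v} [u v x b|u v r Rr|u|u v _|u v w _ uv _ vw].
- by rewrite /relabel !map_cat; apply: pres_cancel.
- by rewrite /relabel !map_cat; apply/pres_relator/RR'.
- exact: pres_refl.
- exact: pres_sym.
- exact: pres_trans uv vw.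
Qed.

Record presents (G : groupType) (H : G -> Prop) (Y : finType) (r : Y -> G)
    (R : seq (word Y)) : Prop := {
  pres_in : forall y, H (r y);
  pres_gen : forall h, H h -> exists w, eval r w = h;
  pres_rels : forall w, w \in R -> eval r w = 1;
  pres_cpl : forall w, eval r w = 1 -> pres_eq [set` R] w [::] }.

Lemma presents_fp (G : groupType) (H : groupClosed G) (Y : finType) (r : Y -> G)
    (R : seq (word Y)) : presents (fun g => g \in H) r R ->
  finitely_presented (subgroup_type H).
Proof.
case=> rH rgen rR rcpl.
pose e (y : Y) : 'I_#|Y| := enum_rank y.
pose d (j : 'I_#|Y|) : Y := enum_val j.
pose R' := map (relabel e) R.
have eK : cancel e d by exact: enum_rankK.
have dK : cancel d e by exact: enum_valK.
have evd w : eval (fun j => r (d j)) (relabel e w) = eval r w.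
  by rewrite eval_relabel; congr (eval _ _); apply/funext => y; rewrite eK.
have R'1 w : w \in R' -> eval (fun j => r (d j)) w = 1.
  by case/mapP => v /rR v1 ->; rewrite evd.
exists #|Y|, R'.
have evH (a : presented [set` R']) : eval_quot (fun j => r (d j)) a \in H.
  rewrite /eval_quot; elim: (repr a) => [|[j b] w IH] /=; first exact: gpred1.
  by apply: gpredM => //; case: b; rewrite ?gpredV; apply: rH.
pose f (a : presented [set` R']) : subgroup_type H := exist _ (eval_quot _ a) (evH a).
have fv a : \val (f a) = eval_quot (fun j => r (d j)) a by [].
have fM : {morph f : a b / a / b >-> a / b}.
  by move=> a b; apply: val_inj; rewrite gmulfF !fv eval_quotM ?eval_quotV.
pose fm := isGroupMorphism.Build (presented [set` R']) (subgroup_type H) f fM.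
pose F0 : group_hom _ _ := HB.pack f fm.
exists F0.
have inj : injective f.
  move=> a b /(congr1 val); rewrite !fv => ab.
  rewrite -[a]pres_reprK -[b]pres_reprK.
  have : eval_quot (fun j => r (d j)) (a / b) = 1 by rewrite eval_quotM ?eval_quotV // ab mulgV.
  rewrite -[a / b]pres_reprK eval_quot_class // => h.
  apply: divg1_eq; rewrite !pres_reprK -[a / b]pres_reprK.
  apply/pres_classP; rewrite -[repr _](relabelK dK).
  apply: (@pres_eq_relabel _ _ e [set` R] _ _ [::]) => [v vR|]; first exact: map_f.
  by apply: rcpl; rewrite eval_relabel.
have surj h : exists a, f a = h.
  have [w wE] := rgen (\val h) (valP h).
  exists (pres_class _ (relabel e w)); apply: val_inj.
  by rewrite fv eval_quot_class // evd.
have /choice [g gK] := surj.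
by exists g => // a; apply: inj; rewrite gK.
Qed.

(** * Finitely generated subgroups of free groups *)

Section FreeFG.
Variables (F : groupType) (X : choiceType) (i : X -> F).
Hypothesis free_i : free_on i.
Variable E : F -> Prop.
Hypothesis sE : subgroup E.

(** The label in E of the edge (x, c) of the Schreier graph. *)
Let r (y : X * F) : F := (rep E (i y.1 * y.2))^-1 * (i y.1 * y.2).

Section Edges.
Variable L : seq (X * F).
Local Notation Z := (seq_sub L).

(** The edges outside the finite list L are read as 1. *)
Definition edge (y : X * F) : free_group Z :=
  if insub y is Some z then pres_class set0 [:: (z, false)] else 1.

(** The word of the edges crossed by the path that leads from the coset E to
gE. *)
Lemma path_ex : exists lam : F -> free_group Z,
  [/\ lam 1 = 1, forall x g, lam (i x * g) = edge (x, rep E g) * lam g,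
    forall x g, lam ((i x)^-1 * g) =
      (edge (x, rep E ((i x)^-1 * g)))^-1 * lam g &
    forall g e, E e -> lam (g * e) = lam g * lam e].
Proof.
pose T := (free_group Z * F)%type.
pose up x (p : T) : T := (edge (x, rep E p.2) * p.1, i x * p.2).
pose dn x (p : T) : T :=
  ((edge (x, rep E ((i x)^-1 * p.2)))^-1 * p.1, (i x)^-1 * p.2).
have updn x : cancel (up x) (dn x).
  by case=> v g; rewrite /up /dn /= !mulKg.
have dnup x : cancel (dn x) (up x).
  by case=> v g; rewrite /up /dn /= !mulVKg.
have [act [act1 actM actX]] := free_act (T := T) free_i updn dnup.
have actV x p : act (i x)^-1 p = dn x p.
  by rewrite -[act _ p](updn x) -actX -actM mulgV act1.
have act2 g p : (act g p).2 = g * p.2.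
  elim/(free_ind free_i): g p => [|x g IH|x g IH] p.
  - by rewrite act1 mul1g.
  - by rewrite actM actX /= IH mulgA.
  - by rewrite actM actV /= IH mulgA.
have actD g e v t : E e -> (act g (v, t * e)).1 = (act g (1, t)).1 * v.
  move=> Ee; elim/(free_ind free_i): g => [|x g IH|x g IH].
  - by rewrite !act1 mul1g.
  - by rewrite !actM !actX /= IH !act2 /= !mulgA (rep_mulr _ sE Ee).
  - by rewrite !actM !actV /= IH !act2 /= !mulgA (rep_mulr _ sE Ee).
exists (fun g => (act g (1, 1)).1); split=> [|x g|x g|g e Ee].
- by rewrite act1.
- by rewrite actM actX /= act2 mulg1.
- by rewrite actM actV /= act2 mulg1.
- rewrite actM [act e _]surjective_pairing act2 mulg1 -{2}[e]mul1g.
  exact: actD.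
Qed.

End Edges.

(** A path crosses finitely many edges; if L contains them all, the product of
their labels telescopes. *)
Lemma path_finite g : exists L0 : seq (X * F), forall L, {subset L0 <= L} ->
  forall lam : F -> free_group (seq_sub L), lam 1 = 1 ->
  (forall x g, lam (i x * g) = edge L (x, rep E g) * lam g) ->
  (forall x g, lam ((i x)^-1 * g) =
      (edge L (x, rep E ((i x)^-1 * g)))^-1 * lam g) ->
  eval_quot (fun z : seq_sub L => r (val z)) (lam g) = (rep E g)^-1 * g.
Proof.
have edgeE L y : y \in L -> eval_quot (fun z : seq_sub L => r (val z)) (edge L y) = r y.
  by move=> yL; rewrite /edge insubT eval_quot_class //= mulg1.
elim/(free_ind free_i): g => [|x g [L0 IH]|x g [L0 IH]].
- exists [::] => L _ lam -> _ _.
  by rewrite eval_quot1 // rep1 // invg1 mulg1.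
- exists ((x, rep E g) :: L0) => L LL lam l1 lX lV.
  rewrite lX eval_quotM // IH // => [|y yL]; last by apply: LL; rewrite inE yL orbT.
  rewrite edgeE ?LL ?mem_head // /r /= (rep_rep _ _ sE).
  by rewrite -!mulgA mulVKg.
- exists ((x, rep E ((i x)^-1 * g)) :: L0) => L LL lam l1 lX lV.
  rewrite lV eval_quotM // eval_quotV // IH // => [|y yL]; last by apply: LL; rewrite inE yL orbT.
  rewrite edgeE ?LL ?mem_head // /r /= (rep_rep _ _ sE) mulVKg.
  by rewrite !invgM invgK -!mulgA mulVKg.
Qed.

(** Reading the edges of a path is a homomorphism lam from E to a free group,
and labels give a left inverse of it; when E is finitely generated, finitely
many edges suffice.  A retract is presented by the relations that identify each
generator of the free group with its image under the retraction. *)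
Lemma free_fg_pres (s : seq F) : (forall g, E g -> gen (fun h => h \in s) g) ->
  (forall g, g \in s -> E g) ->
  exists (Y : finType) (rY : Y -> F) (R : seq (word Y)), presents E rY R.
Proof.
move=> Es sEs.
have /choice [L0 L0P] := path_finite.
pose L := flatten [seq L0 g | g <- s].
pose Z : finType := seq_sub L; pose rZ (z : Z) := r (val z).
have [lam [l1 lX lV lE]] := path_ex L.
have lamV e : E e -> lam e^-1 = (lam e)^-1.
  move=> Ee; apply: (@mulgI _ (lam e)); rewrite -lE ?mulgV //; exact: sgV.
have lamK e : E e -> eval_quot rZ (lam e) = e.
  move=> /Es; elim=> {e} [g gs||g h Gg IHg Gh IHh|g Gg IHg].
  - rewrite /rZ (L0P g) // ?rep_mem ?invg1 ?mul1g //; first exact: sEs.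
    by move=> y yg; apply/flattenP; exists (L0 g) => //; apply: map_f.
  - by rewrite l1 eval_quot1.
  - by rewrite lE ?eval_quotM ?IHg ?IHh //; apply: gen_min Gh.
  - by rewrite lamV ?eval_quotV ?IHg //; apply: gen_min Gg.
have rZE z : E (rZ z) by exact: repP.
pose rel (z : Z) : word Z := (z, true) :: repr (lam (rZ z)).
exists Z, rZ, (map rel (enum Z)); split=> //.
- by move=> e /lamK {}eK; exists (repr (lam e)).
- move=> _ /mapP [z _ ->] /=; rewrite -[eval _ _]/(eval_quot rZ (lam (rZ z))) lamK //.
  exact: mulVg.
move=> w w1; pose R : set (word Z) := [set` map rel (enum Z)]%classic; rewrite -/R.
pose cg z := pres_class R [:: (z, false)] : presented R.
pose pl e := eval_quot cg (lam e).
have cgE z : cg z = pl (rZ z).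
  have : pres_class R (rel z) = 1.
    have Rz : R (rel z) by apply: map_f; rewrite mem_enum.
    by apply/pres_classP; have := pres_relator [::] [::] Rz; rewrite cats0.
  by rewrite -eval_class /= => /mulg1_eq; rewrite invgK.
apply/pres_classP; rewrite -eval_class -/cg.
have -> : cg = (fun z => pl (rZ z)) by apply/funext.
have [_ <-] : E (eval rZ w) /\ pl (eval rZ w) = eval (fun z => pl (rZ z)) w.
  apply: eval_hom => //.
  - exact: sg1.
  - exact: sgV.
  - exact: sgM.
  - by move=> x y _ Ey; rewrite /pl lE // eval_quotM.
by rewrite w1 /pl l1 eval_quot1.
Qed.

End FreeFG.

(** * The subgroup generated by a finite set and a stable letter *)

Lemma presents_eval_eq (F : groupType) (E : F -> Prop) (Y : finType) (r : Y -> F)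
    (R : seq (word Y)) (G : groupType) (c : Y -> G) u v :
  presents E r R -> (forall w, w \in R -> eval c w = 1) ->
  eval r u = eval r v -> eval c u = eval c v.
Proof.
move=> pR cR uv; apply: divg1_eq; rewrite -eval_winv -eval_cat.
apply: (@eval_pres_eq _ _ c [set` R]%classic _ [::]) => //.
by apply: (pres_cpl pR); rewrite eval_cat eval_winv uv mulgV.
Qed.

Section Main.
Variables (F : groupType) (X : choiceType) (i : X -> F).
Hypothesis free_i : free_on i.
Variables (Psi : F -> F) (s0 : seq F).
Hypothesis PsiM : forall g h, Psi (g * h) = Psi g * Psi h.
Hypothesis PsiI : injective Psi.
Variables (M : groupType) (iota : F -> M) (T : M).
Hypothesis iotaM : forall g h, iota (g * h) = iota g * iota h.
Hypothesis iotaI : injective iota.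
Hypothesis Tiota : forall g, T * iota g = iota (Psi g) * T.
Hypothesis Tfree : forall n g, iota g = T ^+ n -> n = 0%N.

Let H : M -> Prop := gen (fun x => x = T \/ exists2 g, g \in s0 & x = iota g).
Let E := window Psi s0.

Let iota1 : iota 1 = 1.
Proof. by apply: (@mulgI _ (iota 1)); rewrite -iotaM !mulg1. Qed.
Let iotaV g : iota g^-1 = (iota g)^-1.
Proof. by apply: (@mulgI _ (iota g)); rewrite -iotaM !mulgV iota1. Qed.

Let sE a b : subgroup (E a b). Proof. exact: window_subgroup. Qed.

Let E_iter n g l : E 0 n g -> E 0 (n + l) (iter l Psi g).
Proof.
move=> Eg; elim: l => [|l IH]; first by rewrite addn0.
by rewrite addnS /=; apply: window_mono (window_Psi PsiM IH).
Qed.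

Let iter_conj l g : T ^+ l * iota g = iota (iter l Psi g) * T ^+ l.
Proof.
elim: l => [|l IH]; first by rewrite expg0 mul1g mulg1.
by rewrite expgS -mulgA IH mulgA Tiota mulgA.
Qed.

Section Tower.
Variables (m : nat) (G : groupType) (tau : G) (psi0 : F -> G).
Hypothesis m0 : (0 < m)%N.
Hypothesis mJ : forall n (u : {malg rat[F]}), (m <= n)%N ->
    cker (E 0 n) u -> cker (E 1 n.+1) u -> cker (E 1 n) u.
Hypothesis psi0M : forall g h, E 0 m g -> E 0 m h -> psi0 (g * h) = psi0 g * psi0 h.
Hypothesis psi0T : forall g, E 0 m.-1 g -> tau * psi0 g = psi0 (Psi g) * tau.

(** The extension from window 0 n to window 0 n.+1 is prescribed on Psi of
window 0 n by conjugation with tau, and the two prescriptions agree on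
window 1 n. *)
Lemma tower N : exists psi : F -> G, [/\ forall g, E 0 m g -> psi g = psi0 g,
  forall g h, E 0 (m + N) g -> E 0 (m + N) h -> psi (g * h) = psi g * psi h &
  forall g, E 0 (m + N).-1 g -> tau * psi g = psi (Psi g) * tau].
Proof.
elim: N => [|N [psi [psi_0 psiM psiT]]]; first by exists psi0; rewrite addn0.
have mN0 : (0 < m + N)%N by rewrite addn_gt0 m0.
have /choice [Pinv PinvP] g : exists h, (exists h', g = Psi h') -> g = Psi h.
  have [[h ->]|nh] := pselect (exists h', g = Psi h'); first by exists h.
  by exists 1.
have PinvK g : Pinv (Psi g) = g.
  by apply: PsiI; rewrite -PinvP //; exists g.
pose f2 g := tau * psi (Pinv g) * tau^-1.
have f2E g : f2 (Psi g) = tau * psi g * tau^-1 by rewrite /f2 PinvK.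
have [] := @amalgam_ext F G (E 0 (m + N)) (E 1 (m + N).+1) (E 1 (m + N))
  (sE _ _) (sE _ _) (sE _ _) _ _ _ psi f2 psiM.
- by move=> g; apply: window_mono.
- by move=> g; apply: window_mono.
- by move=> u; apply: mJ; rewrite leq_addr.
- move=> _ _ /(window_Psi_inv PsiM) [g [Eg ->]] /(window_Psi_inv PsiM) [h [Eh ->]].
  by rewrite -PsiM !f2E psiM // !mulgA mulgVK.
- move=> g; rewrite -{1}(prednK mN0) => /(window_Psi_inv PsiM) [h [Eh ->]].
  by rewrite f2E psiT // mulgK.
move=> psi' [p1 p2 p3]; exists psi'; rewrite addnS /=.
have EG g : E 0 (m + N).+1 g -> gen (fun l => E 0 (m + N) l \/ E 1 (m + N).+1 l) g.
  by apply: window_split.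
split=> [g Eg|g h Eg Eh|g Eg].
- by rewrite p1 ?psi_0 //; apply: window_mono Eg; rewrite ?leq_addr.
- by apply: p3; apply: EG.
- rewrite (p2 (Psi g)); last exact: window_Psi.
  by rewrite f2E mulgVK p1.
Qed.

(** Both in M and in G the word can be brought to the form t^-a e t^b, where e
lies in window 0 (m + l) for a word of length l, so that a single extension psi
serves for the whole word; and t^-a e t^b = 1 forces a = b and e = 1. *)
Lemma tower_word (Y0 : finType) (r0 : Y0 -> F) (c : option Y0 -> G)
    (w : word (option Y0)) :
  (forall y, E 0 m (r0 y)) -> (forall y, c (Some y) = psi0 (r0 y)) -> c None = tau ->
  eval (fun y => if y is Some z then iota (r0 z) else T) w = 1 -> eval c w = 1.
Proof.
move=> r0E cS cN; set r := fun y => _.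
have [psi [psi_0 psiM psiT]] := tower (size w).
have psi1 : psi 1 = 1.
  by apply: (@mulgI _ (psi 1)); rewrite -psiM ?mulg1 //; apply: gen1.
have psiV g : E 0 (m + size w) g -> psi g^-1 = (psi g)^-1.
  move=> Eg; apply: (@mulgI _ (psi g)); rewrite -psiM ?mulgV //.
  exact: genV.
have psi_iter h l : E 0 m h -> (l <= size w)%N ->
    tau ^+ l * psi h = psi (iter l Psi h) * tau ^+ l.
  move=> Eh; elim: l => [|l IH] lw; first by rewrite expg0 mul1g mulg1.
  rewrite expgS -mulgA IH ?(ltnW lw) // mulgA psiT ?mulgA //.
  apply: window_mono (E_iter l Eh) => //; lia.
have key v : (size v <= size w)%N -> exists a b e, [/\ (a <= size v)%N,
    E 0 (m + size v) e, eval r v = T ^- a * iota e * T ^+ b &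
    eval c v = tau ^- a * psi e * tau ^+ b].
  elim: v => [_|[[y|] s] v IH] /=.
  - exists 0%N, 0%N, 1; split=> //; first exact: gen1.
      by rewrite iota1 invg1 !mulg1.
    by rewrite psi1 invg1 !mulg1.
  - move=> vw; have [a [b [e [av Ee -> ->]]]] := IH (ltnW vw).
    have Er : E 0 (m + size w) (r0 y) by apply: window_mono (r0E y); rewrite ?leq_addr.
    have [h [Eh -> ->]] : exists h, [/\ E 0 m h,
        (if s then (iota (r0 y))^-1 else iota (r0 y)) = iota h &
        (if s then (c (Some y))^-1 else c (Some y)) = psi h].
      case: s; last by exists (r0 y); rewrite cS psi_0.
      exists (r0 y)^-1; split; [exact/genV/r0E|by rewrite iotaV|].
      by rewrite psiV // cS psi_0.
    have Eh' : E 0 (m + size w) h by apply: window_mono Eh; rewrite ?leq_addr.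
    have Ei : E 0 (m + size v) (iter a Psi h).
      by apply: window_mono (E_iter a Eh) => //; rewrite leq_add2l.
    exists a, b, (iter a Psi h * e); split.
    + exact: leqW.
    + by rewrite addnS; apply: window_mono (genM Ei Ee).
    + rewrite iotaM !mulgA; congr (_ * _ * _).
      by apply: (@mulgI _ (T ^+ a)); rewrite !mulgA mulgV mul1g iter_conj mulgK.
    + rewrite psiM ?mulgA; last 2 first.
      * by apply: window_mono Ei => //; rewrite leq_add2l ltnW.
      * by apply: window_mono Ee => //; rewrite leq_add2l ltnW.
      congr (_ * _ * _); apply: (@mulgI _ (tau ^+ a)).
      rewrite !mulgA mulgV mul1g psi_iter ?mulgK //.
      exact: leq_trans av (ltnW vw).
  - move=> vw; have [a [b [e [av Ee -> ->]]]] := IH (ltnW vw).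
    rewrite cN; case: s.
      exists a.+1, b, e; rewrite addnS !expgSr !invgM !mulgA; split=> //.
      exact: window_mono Ee.
    case: a av => [_|a av].
      exists 0%N, b.+1, (Psi e); split=> //.
      - by rewrite addnS; apply: window_mono (window_Psi PsiM Ee).
      - by rewrite !invg1 !mul1g mulgA Tiota expgS mulgA.
      - rewrite !invg1 !mul1g mulgA psiT ?expgS ?mulgA //.
        by apply: window_mono Ee => //; rewrite -ltnS prednK ?ltn_add2l // addn_gt0 m0.
    exists a, b, e; split=> //.
    - exact: leq_trans (ltnW av) _.
    - by rewrite addnS; apply: window_mono Ee.
    - by rewrite expgSr invgM !mulgA mulgV mul1g.
    - by rewrite expgSr invgM !mulgA mulgV mul1g.
have [a [b [e [_ Ee -> ->]]]] := key w (leqnn _).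
move=> E1; have {}E1 : iota e = T ^+ a * T ^- b.
  apply: (@mulIg _ (T ^+ b)); apply: (@mulgI _ (T ^- a)).
  by rewrite mulgVK mulVg mulgA.
have ab : a = b.
  have [ba|/ltnW ab] := leqP b a.
    have : iota e = T ^+ (a - b) by rewrite expgnFr.
    by move/Tfree => ab0; lia.
  have : iota e^-1 = T ^+ (b - a) by rewrite iotaV E1 invgM invgK expgnFr.
  by move/Tfree => ab0; lia.
have e1 : e = 1 by apply: iotaI; rewrite iota1 E1 ab mulgV.
by rewrite e1 psi1 mulg1 ab mulVg.
Qed.

End Tower.

(** The relators are those of window 0 m, and t x t^-1 = Psi x for the
generators x of window 0 m.-1. *)
Theorem torus_pres : exists (Y : finType) (r : Y -> M) (R : seq (word Y)), presents H r R.
Proof.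
have [m [m0 mJ]] := cker_window free_i s0 PsiM.
have [Y0 [r0 [R0 pR0]]] := free_fg_pres free_i (sE 0 m) (s := levels Psi s0 0 m)
  (fun g Eg => Eg) (fun g lg => gen_in lg).
have r0E := pres_in pR0.
have /choice [wd wdP] g : exists w, E 0 m g -> eval r0 w = g.
  have [/(pres_gen pR0) [w ?]|nE] := pselect (E 0 m g); first by exists w.
  by exists [::].
pose Y : finType := option Y0.
pose r (y : Y) := if y is Some z then iota (r0 z) else T.
pose up : word Y0 -> word Y := relabel Some.
pose rel x : word Y := (None, false) :: up (wd x) ++ (None, true) :: winv (up (wd (Psi x))).
pose R := map up R0 ++ map rel (levels Psi s0 0 m.-1).
have evup w : eval r (up w) = iota (eval r0 w).
  rewrite /up eval_relabel; elim: w => [|[y b] w IH] /=; first by rewrite iota1.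
  by rewrite IH iotaM; case: b; rewrite ?iotaV.
have EPsi g : E 0 m.-1 g -> E 0 m g /\ E 0 m (Psi g).
  move=> Eg; split; first by apply: window_mono Eg; rewrite ?leq_pred.
  by apply: window_mono (window_Psi PsiM Eg); rewrite ?prednK.
have EH g : E 0 m g -> H (iota g).
  elim=> {g} [g /levelsP [l [x [_ xs ->]]]||g h _ Hg _ Hh|g _ Hg].
  - elim: l => [|l IH] /=; first by apply: gen_in; right; exists x.
    have -> : iota (Psi (iter l Psi x)) = T * iota (iter l Psi x) * T^-1.
      by rewrite Tiota mulgK.
    have HT : H T by apply: gen_in; left.
    exact: genM (genM HT IH) (genV HT).
  - by rewrite iota1; apply: gen1.
  - by rewrite iotaM; apply: genM.
  - by rewrite iotaV; apply: genV.
exists Y, r, R; split.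
- by case=> [y|] /=; [apply: EH|apply: gen_in; left].
- move=> h; elim=> {h} [h [->|[g gs ->]]||g h _ [u <-] _ [v <-]|g _ [u <-]].
  + by exists [:: (None, false)]; rewrite /= mulg1.
  + have /(pres_gen pR0) [w <-] : E 0 m g.
      by apply/gen_in/levelsP; exists 0%N, g; rewrite m0.
    by exists (up w).
  + by exists [::].
  + by exists (u ++ v); rewrite eval_cat.
  + by exists (winv u); rewrite eval_winv.
- move=> w; rewrite mem_cat => /orP [/mapP [u uR ->]|/mapP [x xl ->]].
    by rewrite evup (pres_rels pR0 uR) iota1.
  have /EPsi [Ex EPx] : E 0 m.-1 x by apply: gen_in.
  rewrite /rel /= eval_cat /= eval_winv !evup !wdP // mulgA Tiota.
  by rewrite -[_ * T * _]mulgA mulVKg mulgV.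
move=> w w1; apply/pres_classP; rewrite -eval_class.
pose c (y : Y) : presented [set` R]%classic := pres_class _ [:: (y, false)].
rewrite -/c; have cR u : u \in R -> eval c u = 1.
  move=> uR; rewrite /c eval_class; apply/pres_classP.
  by have := pres_relator [::] [::] (uR : [set` R]%classic u); rewrite cats0.
have cR0 u : u \in R0 -> eval (fun y => c (Some y)) u = 1.
  by move=> uR; rewrite -eval_relabel; apply: cR; rewrite mem_cat map_f.
pose psi0 g := eval (fun y => c (Some y)) (wd g).
have psi0E g u : E 0 m g -> eval r0 u = g -> psi0 g = eval (fun y => c (Some y)) u.
  by move=> Eg ug; apply: (presents_eval_eq pR0 cR0); rewrite wdP.
have psi0M g h : E 0 m g -> E 0 m h -> psi0 (g * h) = psi0 g * psi0 h.
  move=> Eg Eh; rewrite (psi0E _ (wd g ++ wd h)) ?eval_cat ?wdP //.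
  exact: genM.
have psi0V g : E 0 m g -> psi0 g^-1 = (psi0 g)^-1.
  move=> Eg; rewrite (psi0E _ (winv (wd g))) ?eval_winv ?wdP //; exact: genV.
apply: (@tower_word m _ (c None) psi0 m0 mJ psi0M _ Y0 r0 c w r0E) => //.
- move=> g; elim=> {g} [g gl||g h Eg IHg Eh IHh|g Eg IHg].
  + have : eval c (rel g) = 1 by apply: cR; rewrite mem_cat map_f ?orbT.
    rewrite /rel /= eval_cat /= eval_winv /up !eval_relabel -/(psi0 g) -/(psi0 (Psi g)).
    by rewrite !mulgA => /divg1_eq /(congr1 (fun x => x * c None)); rewrite mulgVK.
  + have p1 : psi0 1 = 1 by rewrite (psi0E _ [::]) //; apply: gen1.
    by rewrite (Psi1 PsiM) p1 mul1g mulg1.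
  + have [? ?] := EPsi _ Eg; have [? ?] := EPsi _ Eh.
    by rewrite PsiM !psi0M // mulgA IHg -mulgA IHh mulgA.
  + have [? ?] := EPsi _ Eg; rewrite (PsiV PsiM) !psi0V //.
    apply: (@mulgI _ (psi0 (Psi g))); rewrite mulgA -IHg !mulgA mulgK.
    by rewrite mulgV mul1g.
- by move=> y; rewrite (psi0E _ [:: (y, false)]) //= mulg1.
Qed.

End Main.

(** * Mapping tori *)

Section Torus.
Variables (F : groupType) (Phi : group_hom F F).
Hypothesis PhiI : injective Phi.
Local Notation M := (mapping_torus Phi).
Local Notation Rel := (torus_relators Phi).

Definition torus_base (g : F) : M := pres_class Rel [:: (Some g, false)].
Definition torus_stable : M := pres_class Rel [:: (None, false)].
Local Notation T := torus_stable.
Local Notation iota := torus_base.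

Lemma torus_classM (u v : word (option F)) :
  pres_class Rel (u ++ v) = (pres_class Rel u : M) * (pres_class Rel v : M).
Proof. by rewrite -[RHS]/(pres_mul _ _) pres_mulE. Qed.

Lemma torus_classV (u : word (option F)) :
  pres_class Rel (winv u) = (pres_class Rel u : M)^-1.
Proof. by rewrite -[RHS]/(pres_inv _) pres_invE. Qed.

Lemma torus_class_rel u : Rel u -> pres_class Rel u = 1 :> M.
Proof.
by move=> uR; apply/pres_classP; have := pres_relator [::] [::] uR; rewrite cats0.
Qed.

Lemma torus_baseM g h : iota (g * h) = iota g * iota h.
Proof.
have /torus_class_rel : Rel (tor_elt g ++ tor_elt h ++ winv (tor_elt (g * h))).
  by left; exists (g, h).
by rewrite !torus_classM torus_classV mulgA => /divg1_eq.
Qed.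

Lemma torus_base_conj g : T * iota g = iota (Phi g) * T.
Proof.
have /torus_class_rel : Rel (tor_t F ++ tor_elt g ++ winv (tor_t F) ++ winv (tor_elt (Phi g))).
  by right; exists g.
rewrite !torus_classM !torus_classV !mulgA => /divg1_eq E.
by rewrite -[iota (Phi g)]/(pres_class Rel (tor_elt (Phi g))) -E mulgVK.
Qed.

Lemma torus_base1 : iota 1 = 1.
Proof. by apply: (@mulgI _ (iota 1)); rewrite -torus_baseM !mulg1. Qed.

Lemma torus_baseV g : iota g^-1 = (iota g)^-1.
Proof. by apply: (@mulgI _ (iota g)); rewrite -torus_baseM !mulgV torus_base1. Qed.

Lemma iterPhiM l g h : iter l Phi (g * h) = iter l Phi g * iter l Phi h.
Proof. by elim: l => //= l ->; rewrite gmulfM. Qed.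

Lemma iterPhiI l : injective (iter l Phi).
Proof. by elim: l => [|l IH] g h //= /PhiI /IH. Qed.

Lemma torus_base_iter l g : T ^+ l * iota g = iota (iter l Phi g) * T ^+ l.
Proof.
elim: l => [|l IH]; first by rewrite expg0 mul1g mulg1.
by rewrite expgS -mulgA IH mulgA torus_base_conj mulgA.
Qed.

(** The pair (n, f) stands for t^-n f t^n, or rather for its class modulo the
right multiplication by powers of t; the letters act on these classes, which
shows that the base embeds. *)
Let lact (l : option F * bool) (p : nat * F) : nat * F :=
  match l with
  | (Some g, b) => (p.1, iter p.1 Phi (if b then g^-1 else g) * p.2)
  | (None, false) => (p.1, Phi p.2)
  | (None, true) => (p.1.+1, p.2)
  end.
Let wact (w : word (option F)) p := foldr lact p w.
Let same (p q : nat * F) := iter q.1 Phi p.2 = iter p.1 Phi q.2.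

Let same_trans p q r : same p q -> same q r -> same p r.
Proof.
rewrite /same => pq qr; apply: (@iterPhiI q.1).
by rewrite -!iterD addnC iterD pq -iterD addnC iterD qr -!iterD addnC.
Qed.

Let same_lact l p q : same p q -> same (lact l p) (lact l q).
Proof.
rewrite /same; case: l => [[g|] b] /= pq.
  by rewrite !iterPhiM pq -!iterD addnC.
by case: b; rewrite /= -?iterSr /= pq // -iterSr.
Qed.

Let same_wact w p q : same p q -> same (wact w p) (wact w q).
Proof. by move=> pq; elim: w => //= l w IH; apply: same_lact. Qed.

Let wact_cat u v p : wact (u ++ v) p = wact u (wact v p).
Proof. exact: foldr_cat. Qed.

Lemma iterPhiV l g : iter l Phi g^-1 = (iter l Phi g)^-1.
Proof. by elim: l => //= l ->; rewrite gmulfV. Qed.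

Let wact_pres u v : pres_eq Rel u v -> forall p, same (wact u p) (wact v p).
Proof.
elim=> {u v}.
- move=> u v x b p; rewrite !wact_cat; apply: same_wact.
  case: x => [g|]; case: b; rewrite /same /= -?iterSr //.
    by rewrite iterPhiV mulKg.
  by rewrite iterPhiV mulVKg.
- move=> u v r rR p; rewrite !wact_cat; apply: same_wact.
  set q := wact v p.
  case: rR => [[[g h] _ <-]|[g _ <-]]; rewrite /same /=.
    by congr (iter _ _ _); rewrite iterPhiV iterPhiM invgM -!mulgA !mulVKg.
  have PhiE : iter q.1 Phi (Phi g) = Phi (iter q.1 Phi g) by rewrite -iterSr.
  by rewrite iterPhiV PhiE mulVKg -iterSr.
- by [].
- by move=> u v _ uv p; rewrite /same uv.
- by move=> u v w _ uv _ vw p; apply: same_trans (uv p) (vw p).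
Qed.

Lemma torus_baseI : injective iota.
Proof.
move=> g h /pres_classP /wact_pres /(_ (0%N, 1)).
by rewrite /same /= !mulg1.
Qed.

Let wt (w : word (option F)) : int :=
  foldr (fun (l : option F * bool) (z : int) =>
    ((if l.1 is Some _ then 0 else if l.2 then -1 else 1) + z)%R) 0%R w.

Let wt_cat u v : wt (u ++ v) = (wt u + wt v)%R.
Proof. by elim: u => [|l u IH] /=; rewrite ?add0r // IH addrA. Qed.

Let wt_pres u v : pres_eq Rel u v -> wt u = wt v.
Proof.
elim=> {u v} //.
- by move=> u v [g|] b; rewrite !wt_cat; congr (_ + _)%R; case: b; rewrite /= ?add0r ?addr0 //; lia.
- move=> u v r [[[g h] _ <-]|[g _ <-]]; rewrite !wt_cat; congr (_ + _)%R; rewrite /=; lia.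
- by move=> u v w _ -> _ ->.
Qed.

Definition stable_exp (a : M) : int := wt (repr a).

Lemma stable_exp_class w : stable_exp (pres_class Rel w) = wt w.
Proof. exact/wt_pres/pres_repr. Qed.

Lemma stable_expM a b : stable_exp (a * b) = (stable_exp a + stable_exp b)%R.
Proof. by rewrite -[a * b]/(pres_class _ _) stable_exp_class wt_cat. Qed.

Lemma stable_exp1 : stable_exp 1 = 0%R.
Proof. by rewrite -[1 : M]/(pres_class _ _) stable_exp_class. Qed.

Lemma stable_expV a : stable_exp a^-1 = (- stable_exp a)%R.
Proof. by apply/eqP; rewrite -addr_eq0 -stable_expM mulVg stable_exp1. Qed.

Lemma stable_expX a n : stable_exp (a ^+ n) = (stable_exp a *+ n)%R.
Proof. by elim: n => [|n IH]; rewrite ?stable_exp1 // expgS stable_expM IH mulrS. Qed.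

Lemma stable_exp_base g : stable_exp (iota g) = 0%R.
Proof. by rewrite stable_exp_class /= addr0. Qed.

Lemma stable_exp_stable : stable_exp T = 1%R.
Proof. by rewrite stable_exp_class /= addr0. Qed.

Lemma torus_elt a : exists n g m, a = T ^- n * iota g * T ^+ m.
Proof.
rewrite -[a]pres_reprK; elim: (repr a) => [|[[h|] b] w [n [g [m E]]]].
- by exists 0%N, 1, 0%N; rewrite torus_base1 invg1 !mulg1.
- have bE : pres_class Rel [:: (Some h, b)] = iota (if b then h^-1 else h).
    by case: b => //; rewrite torus_baseV -torus_classV.
  pose h' := if b then h^-1 else h.
  have -> : pres_class Rel ((Some h, b) :: w) = iota h' * pres_class Rel w.
    by rewrite -cat1s torus_classM bE.
  exists n, (iter n Phi h' * g), m; rewrite E torus_baseM !mulgA; congr (_ * _ * _).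
  by apply: (@mulgI _ (T ^+ n)); rewrite !mulgA mulgV mul1g torus_base_iter mulgK.
- have -> : pres_class Rel ((None, b) :: w) = (if b then T^-1 else T) * pres_class Rel w.
    by rewrite -cat1s torus_classM; congr (_ * _); case: b => //; rewrite -torus_classV.
  rewrite E; case: b.
    by exists n.+1, g, m; rewrite expgSr invgM !mulgA.
  case: n E => [|n] _.
    exists 0%N, (Phi g), m.+1.
    by rewrite !invg1 !mul1g mulgA torus_base_conj expgS mulgA.
  by exists n, g, m; rewrite expgSr invgM !mulgA mulgV mul1g.
Qed.

Lemma torus_ker a : stable_exp a = 0%R -> exists n g, a = T ^- n * iota g * T ^+ n.
Proof.
have [n [g [m ->]]] := torus_elt a.
rewrite !stable_expM stable_expV !stable_expX stable_exp_base stable_exp_stable addr0 => E.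
by exists n, g; congr (_ * _ ^+ _); lia.
Qed.

Lemma torus_ker_shift n m g : (n <= m)%N ->
  T ^- n * iota g * T ^+ n = T ^- m * iota (iter (m - n) Phi g) * T ^+ m.
Proof.
move=> /subnK; move: (m - n)%N => l <-.
by rewrite expgnDr invgM !mulgA -[_ * T ^+ l]mulgA -torus_base_iter !mulgA mulgVK.
Qed.

Hypothesis hF : is_free F.
Variable H : groupClosed M.
Variable s : seq M.
Hypothesis sH : forall x, x \in H <-> gen (fun y => y \in s) x.

Lemma torus_ker_fp : (forall x, x \in s -> stable_exp x = 0%R) ->
  finitely_presented (subgroup_type H).
Proof.
move=> s0; have [X [i free_i]] := free_onP hF.
have [N [fs fsE]] : exists N (fs : seq F),
    s = [seq T ^- N * iota g * T ^+ N | g <- fs].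
  elim: s s0 => [|x s' IH] s0; first by exists 0%N, [::].
  have [|N [fs ->]] := IH; first by move=> y ys; apply: s0; rewrite inE ys orbT.
  have [n [g ->]] := torus_ker (s0 x (mem_head _ _)).
  exists (maxn n N), (iter (maxn n N - n) Phi g :: [seq iter (maxn n N - N) Phi h | h <- fs]).
  rewrite /= -torus_ker_shift ?leq_maxl // -map_comp; congr (_ :: _).
  by apply: eq_map => h /=; rewrite -torus_ker_shift ?leq_maxr.
pose E := gen (fun g => g \in fs).
pose c g := T ^- N * iota g * T ^+ N.
have cM g h : c (g * h) = c g * c h by rewrite /c torus_baseM !mulgA mulgK.
have c1 : c 1 = 1 by rewrite /c torus_base1 mulg1 mulVg.
have cV g : c g^-1 = (c g)^-1.
  by apply: (@mulgI _ (c g)); rewrite -cM !mulgV c1.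
have cI g : c g = 1 -> g = 1.
  move=> cg; apply: torus_baseI; rewrite torus_base1.
  by apply: (@mulgI _ (T ^- N)); apply: (@mulIg _ (T ^+ N)); rewrite -/(c g) cg mulg1 mulVg.
have [Y [r [R [rE rgen rR rcpl]]]] := free_fg_pres free_i (gen_subgroup _)
  (fun g (Eg : E g) => Eg) (fun g gfs => gen_in gfs).
have evc w : eval (fun y => c (r y)) w = c (eval r w).
  elim: w => [|[y b] w IH] /=; first by rewrite c1.
  by rewrite IH cM; case: b; rewrite ?cV.
apply: (@presents_fp _ _ Y (fun y => c (r y)) R); split=> [y|h|w wR|w].
- apply/sH; elim: (rE y) => {y} [g gfs||g h _ Hg _ Hh|g _ Hg].
  + by apply: gen_in; rewrite fsE; apply/mapP; exists g.
  + by rewrite c1; apply: gen1.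
  + by rewrite cM; apply: genM.
  + by rewrite cV; apply: genV.
- move/sH; elim=> {h} [h|| g h _ [u <-] _ [v <-]|g _ [u <-]].
  + rewrite fsE => /mapP [g gfs ->]; have [w <-] := rgen g (gen_in gfs).
    by exists w; rewrite evc.
  + by exists [::].
  + by exists (u ++ v); rewrite eval_cat.
  + by exists (winv u); rewrite eval_winv.
- by rewrite evc rR // c1.
- by rewrite evc => /cI /rcpl.
Qed.

(** Let t = T^-n f T^(d+n) be an element of H of least exponent d > 0.  Then t
acts on the conjugate T^-n F T^n of the base as g |-> f Phi^d(g) f^-1, and
every x in H can be written t^-a g t^b with g in that conjugate. *)
Lemma torus_nonker_fp x0 : x0 \in s -> stable_exp x0 != 0%R ->
  finitely_presented (subgroup_type H).
Proof.
move=> x0s x00; have [X [i free_i]] := free_onP hF.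
have exd : exists d, `[< (0 < d)%N /\ exists2 x, x \in H & stable_exp x = Posz d >].
  exists `|stable_exp x0|%N; apply/asboolP; split; first by rewrite absz_gt0.
  have x0H : x0 \in H by apply/sH/gen_in.
  case xE: (stable_exp x0) => [q|q]; first by exists x0.
  by exists x0^-1; rewrite ?gpredV // stable_expV xE.
case: (ex_minnP exd) => d /asboolP [d0 [t tH td]] dmin.
have [n [f [m tE]]] := torus_elt t.
have mE : m = (d + n)%N.
  by move: td; rewrite tE !stable_expM stable_expV !stable_expX stable_exp_base stable_exp_stable; lia.
pose io g : M := T ^- n * iota g * T ^+ n.
pose Psi g := f * iter d Phi g * f^-1.
have PsiM g h : Psi (g * h) = Psi g * Psi h.
  by rewrite /Psi iterPhiM !mulgA mulgVK.
have PsiI : injective Psi.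
  by move=> g h /mulIg /mulgI; apply: iterPhiI.
have ioM g h : io (g * h) = io g * io h by rewrite /io torus_baseM !mulgA mulgK.
have ioI : injective io by move=> g h /mulIg /mulgI; apply: torus_baseI.
have tio g : t * io g = io (Psi g) * t.
  rewrite /io tE mE /Psi expgnDr !torus_baseM torus_baseV !mulgA !mulgK mulgVK.
  by congr (_ * _); rewrite -!mulgA torus_base_iter.
(* Conjugation by t lowers by d the power of T that is needed to bring an
   element of exponent 0 into the base, until the image of io is reached. *)
have shift a g : exists l h, t ^+ l * (T ^- a * iota g * T ^+ a) * t ^- l = io h.
  have [k] := ubnP a; elim: k a g => // k IH a g ak.
  have [an|na] := leqP a n.
    by exists 0%N, (iter (n - a) Phi g); rewrite (torus_ker_shift _ an) invg1 mul1g mulg1.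
  have [adn|/ltnW dna] := leqP a (d + n).
    exists 1%N, (f * iter (d + n - a) Phi g * f^-1).
    rewrite (torus_ker_shift _ adn) expg1 tE mE /io !invgM invgK !torus_baseM torus_baseV.
    by rewrite !mulgA !mulgK.
  pose e := (a - (d + n))%N; have aE : a = (e + (d + n))%N by rewrite subnK.
  have [l [h lE]] := IH (e + n)%N (iter e Phi f * g * iter e Phi f^-1) ltac:(lia).
  have u1 : t * T ^- a = T ^- (e + n) * iota (iter e Phi f).
    apply: (@mulgI _ (T ^+ (e + n))); rewrite mulVKg tE mE aE !expgnDr !invgM !mulgA.
    by rewrite !mulgK torus_base_iter mulgK.
  have u2 : T ^+ a * t^-1 = (iota (iter e Phi f))^-1 * T ^+ (e + n).
    by apply: invg_inj; rewrite !invgM !invgK u1.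
  exists l.+1, h; rewrite -lE expgSr invgM.
  have -> : T ^- (e + n) * iota (iter e Phi f * g * iter e Phi f^-1) * T ^+ (e + n) =
      t * (T ^- a * iota g * T ^+ a) * t^-1.
    rewrite !torus_baseM iterPhiV torus_baseV !mulgA u1 -[_ * T ^+ a * t^-1]mulgA u2 !mulgA.
    by [].
  by rewrite !mulgA.
have eltH x : x \in H -> exists a b g, t ^+ a * x = io g * t ^+ b.
  move=> xH.
  have [a [b abE]] : exists a b : nat, (stable_exp x %/ Posz d)%Z = (Posz b - Posz a)%R.
    case: (stable_exp x %/ Posz d)%Z => q; first by exists 0%N, q; rewrite subr0.
    by exists q.+1, 0%N; rewrite NegzE sub0r.
  pose y := t ^+ a * x * t ^- b.
  have yH : y \in H.
    by apply: gpredM; [apply: gpredM|rewrite gpredV]; rewrite ?gpredXn.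
  have yE : stable_exp y = (stable_exp x %% Posz d)%Z.
    have := divz_eq (stable_exp x) (Posz d); rewrite abE => xE.
    have dX l : (Posz d *+ l)%R = (Posz d * Posz l)%R by rewrite -mulr_natr natz.
    rewrite /y !stable_expM stable_expV !stable_expX td !dX.
    by move: (stable_exp x %% Posz d)%Z xE => q ->; ring.
  have y0 : stable_exp y = 0%R.
    have dz : (Posz d != 0)%R by lia.
    have y_ge0 : (0 <= stable_exp y)%R by rewrite yE modz_ge0.
    have y_lt : (stable_exp y < Posz d)%R by rewrite yE ltz_pmod.
    case qE: (stable_exp y) y_ge0 y_lt => [[//|q]|//] _ qd.
    suff /dmin : `[< (0 < q.+1)%N /\ exists2 x, x \in H & stable_exp x = Posz q.+1 >] by lia.
    by apply/asboolP; split=> //; exists y.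
  have [c [h yh]] := torus_ker y0; have [l [g lE]] := shift c h.
  exists (l + a)%N, (l + b)%N, g; rewrite -lE -yh /y !expgnDr !mulgA.
  by rewrite !mulgVK.
have /choice [p pP] x : exists p : nat * nat * F,
    x \in H -> t ^+ p.1.1 * x = io p.2 * t ^+ p.1.2.
  have [xH|] := boolP (x \in H); last by exists (0%N, 0%N, 1).
  by have [a [b [g E]]] := eltH x xH; exists (a, b, g).
have tfree k g : io g = t ^+ k -> k = 0%N.
  move/(congr1 stable_exp); rewrite /io !stable_expM stable_expV !stable_expX stable_exp_base stable_exp_stable td; lia.
have [Y [r [R pR]]] := torus_pres free_i [seq (p x).2 | x <- s] PsiM PsiI ioM ioI tio tfree.
apply: (@presents_fp _ _ Y r R).
set H' := gen _ in pR; suff -> : (fun g => g \in H) = H' :> (M -> Prop) by [].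
have sHs x : x \in s -> x \in H by move=> xs; apply/sH/gen_in.
apply/funext => x; apply/propext; split=> [/sH|].
  apply: gen_mono => {}x xs; have /pP E := sHs _ xs.
  have Ht : H' t by apply: gen_in; left.
  have HX k : H' (t ^+ k).
    by elim: k => [|k IH]; [apply: gen1|rewrite expgS; apply: genM].
  have -> : x = t ^- (p x).1.1 * (io (p x).2 * t ^+ (p x).1.2) by rewrite -E mulKg.
  apply: genM; first exact/genV/HX.
  apply: genM; last exact: HX.
  by apply: gen_in; right; exists (p x).2 => //; apply: map_f.
elim=> {x} [x [->|[g /mapP [x' /sHs x'H ->] ->]]||g h _ Hg _ Hh|g _ Hg] //.
- have -> : io (p x').2 = t ^+ (p x').1.1 * x' * t ^- (p x').1.2.
    by rewrite pP // mulgK.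
  by apply: gpredM; [apply: gpredM|rewrite gpredV]; rewrite ?gpredXn.
- exact: gpred1.
- exact: gpredM.
- by rewrite gpredV.
Qed.

End Torus.

Theorem theorem1p1 (F : groupType) (hF : is_free F) (Phi : group_hom F F)
    (hPhi : injective Phi) :
  coherent (mapping_torus Phi).
Proof.
move=> H [sH sHgen].
pose s := map val sH.
have HE x : x \in H <-> gen (fun y => y \in s) x.
  split=> [xH|]; last first.
    elim=> {x} [x /mapP [y _ ->]||x y _ xH _ yH|x _ xH].
    - exact: valP.
    - exact: gpred1.
    - exact: gpredM.
    - by rewrite gpredV.
  pose K : {pred subgroup_type H} := fun x => `[< gen (fun y => y \in s) (val x) >].
  have KV : invg_closed K.
    by move=> y /asboolP Ky; apply/asboolP; rewrite gmulfV; apply: genV.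
  have K1 : 1 \in K by apply/asboolP; rewrite gmulf1; apply: gen1.
  have KM : mulg_closed K.
    move=> y z /asboolP Ky /asboolP Kz; apply/asboolP; rewrite gmulfM.
    exact: genM.
  pose Kg : groupClosed (subgroup_type H) :=
    HB.pack K (isInvClosed.Build _ K KV) (isMul1Closed.Build _ K K1)
      (isMulClosed.Build _ K KM).
  have sK : {subset sH <= Kg} by move=> y ys; apply/asboolP/gen_in/map_f.
  by have /asboolP := sHgen Kg sK (exist _ x xH : subgroup_type H).
have [/hasP [x0 xs x0n]|/hasPn all0] := boolP (has (fun x => stable_exp x != 0%R) s).
  exact: (torus_nonker_fp hPhi hF HE xs x0n).
by apply: (torus_ker_fp hPhi hF HE) => x /all0; rewrite negbK => /eqP.
Qed.
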